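(* Let $\mathcal{M}=(\mathcal{T},\mathcal{E},\mathcal{P})$ be a mesh of $\Omega$ which is regular with parameters $\mu,\lambda\in(0,\frac12]$. Then there exists a constant $C=C(\Omega,\lambda)$, depending only on $\Omega$ and $\lambda$, such that, for all $u\in\mathbb{R}^{\mathcal{T}}$, $$|u^{\mathcal{M}}|(x)\le C\left(\|u\|_{0,1}+\int_\Omega\frac{|\nabla^{\mathcal{M}}u|(\xi)}{|x-\xi|^{d-1}}\,\mathrm{d}\xi\right)\qquad\text{for a.e. }x\in\Omega .$$
   Context: Domain. Let $d\ge 2$ be an integer and let $\Omega\subset\mathbb{R}^d$ be a bounded, connected, open polyhedral set, i.e. an open set whose closure equals the closure of a finite union of polyhedra, a polyhedron being a bounded intersection of finitely many half-spaces (possibly non-convex); $\Omega$ is moreover a Lipschitz domain. It satisfies a uniform cone condition: there is an open finite circular cone $k_\Omega$, fixed once and for all and regarded as part of the data of $\Omega$, such that every $x\in\overline\Omega$ is the vertex of a cone $k_\Omega(x)\subset\Omega$ congruent to $k_\Omega$. $|\cdot|$ denotes the Euclidean norm of vectors, and for sets the $d$- or $(d-1)$-dimensional Hausdorff measure, as appropriate. $B(a,r)$ is the open ball of center $a$ and radius $r$ in $\mathbb{R}^d$, and $B_{d'}$ is the unit open ball of $\mathbb{R}^{d'}$. Mesh. A mesh $\mathcal{M}=(\mathcal{T},\mathcal{E},\mathcal{P})$ of $\Omega$ consists of a set $\mathcal{T}$ of open connected polyhedral subsets of $\Omega$ (cells), a set $\mathcal{E}$ of non-empty relatively open connected polyhedral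 subsets of hyperplanes of $\mathbb{R}^d$ (faces), and a family $\mathcal{P}=(x_K)_{K\in\mathcal{T}}$ of points of $\Omega$ (cell centers), such that: (i) $\overline\Omega=\bigcup_{K\in\mathcal{T}}\overline K$; (ii) for each $K\in\mathcal{T}$ there is $\mathcal{E}_K\subset\mathcal{E}$ with $\partial K=\bigcup_{\sigma\in\mathcal{E}_K}\overline\sigma$ and $|\sigma\cap\sigma'|=0$ for distinct $\sigma,\sigma'\in\mathcal{E}_K$, and $\mathcal{E}=\bigcup_K\mathcal{E}_K$; (iii) for $K\ne L$ in $\mathcal{T}$, either $|\overline K\cap\partial L|=|\partial K\cap\overline L|=0$, or $\mathcal{E}_{KL}:=\mathcal{E}_K\cap\mathcal{E}_L$ is non-empty and $\overline K\cap\overline L=\bigcup_{\sigma\in\mathcal{E}_{KL}}\overline\sigma$; the set of interior faces is $\mathcal{E}_{\rm int}=\{\sigma\in\mathcal{E}:\exists K\neq L,\ \sigma\in\mathcal{E}_{KL}\}$; (iv) with $\mathcal{E}_{\rm ext}=\{\sigma\in\mathcal{E}:\sigma\subset\partial\Omega\}$, for each $K$ either $|\overline K\cap\partial\Omega|=0$ or $\overline K\cap\partial\Omega=\bigcup_{\sigma\in\mathcal{E}_K\cap\mathcal{E}_{\rm ext}}\overline\sigma$; (v) $x_K\in K$ for all $K$. For $\sigma\in\mathcal{E}_{\rm int}$ the pair $\{K,L\}$ with $\sigma\in\mathcal{E}_{KL}$ is unique. The mesh size is $h=\max_{K\in\mathcal{T}}\operatorname{diam}(K)$. Regularity. The mesh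 is regular with parameters $\mu,\lambda\in(0,\frac12]$ if every $K\in\mathcal{T}$ is star-shaped with respect to the ball $B(x_K,\mu h)$, and $\lambda^{d-1}h^{d-1}|B_{d-1}|\le|\sigma|$ for every $\sigma\in\mathcal{E}$. Dual mesh and discrete gradient. $P_{K\sigma}$ is the open $d$-dimensional pyramid with base $\sigma\in\mathcal{E}_K$ and vertex $x_K$. For $\sigma\in\mathcal{E}_{\rm int}$, $\sigma\in\mathcal{E}_{KL}$, the diamond cell $D_\sigma$ is the interior of $\overline{P_{K\sigma}\cup P_{L\sigma}}$. $n_{K\sigma}$ is the unit normal on $\sigma$ outward to $K$. For $u=(u_K)_{K\in\mathcal{T}}\in\mathbb{R}^{\mathcal{T}}$ let $u^{\mathcal{M}}=\sum_K u_K\mathbf{1}_K$, $\|u\|_{0,1}=\|u^{\mathcal{M}}\|_{L^1(\Omega)}$ and $$\nabla^{\mathcal{M}}u=\sum_{\sigma\in\mathcal{E}_{\rm int},\,\sigma\in\mathcal{E}_{KL}}|\sigma|\frac{u_L-u_K}{|D_\sigma|}\,n_{K\sigma}\mathbf{1}_{D_\sigma}.$$ A constant depending only on listed data is independent of everything else, in particular of the mesh and of $u$. *)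

(* Defs.v *)
From HB Require Import structures.
From mathcomp Require Import all_boot all_order all_algebra.
From mathcomp Require Import all_classical all_reals all_analysis.
From mathcomp Require Import measurable_realfun.

Set Implicit Arguments.
Unset Strict Implicit.
Unset Printing Implicit Defensive.

Import Order.TTheory GRing.Theory Num.Theory.
Import numFieldNormedType.Exports.

Local Open Scope classical_set_scope.
Local Open Scope ring_scope.

(* R^n is 'rV[R]_n.  The norm provided by the library on matrices is the max
   norm: it is used for the topology only, Euclidean lengths are [enorm]. *)
Definition dotv (R : realType) (n : nat) (x y : 'rV[R]_n) : R :=
  \sum_(i < n) x ord0 i * y ord0 i.

Definition enorm (R : realType) (n : nat) (x : 'rV[R]_n) : R :=
  Num.sqrt (dotv x x).

Definition eball (R : realType) (n : nat) (a : 'rV[R]_n) (r : R) :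
    set 'rV[R]_n :=
  [set x | enorm (x - a) < r].

Definition diam (R : realType) (n : nat) (A : set 'rV[R]_n) : R :=
  sup [set t | exists x y, [/\ A x, A y & t = enorm (x - y)]].

Definition boundary (T : topologicalType) (A : set T) : set T :=
  closure A `\` interior A.

Notation borelRV R n := (g_sigma_algebraType (@open 'rV[R]_n)).

Section LebesgueRV.
Variable R : realType.

Definition consRV (n : nat) (p : measurableTypeR R * borelRV R n) :
    borelRV R n.+1 :=
  row_mx (\row_(_ < 1) (p.1 : R)) (p.2 : 'rV[R]_n).

Definition unconsRV (n : nat) (v : borelRV R n.+1) :
    measurableTypeR R * borelRV R n :=
  ((v : 'rV[R]_(1 + n)) ord0 (lshift n ord0), rsubmx (v : 'rV[R]_(1 + n))).

Lemma consRV_head (n : nat) (p : measurableTypeR R * borelRV R n)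
    (i l : 'I_1) :
  (consRV p : 'rV[R]_(1 + n)) i (lshift n l) = p.1.
Proof. by rewrite /consRV row_mxEl mxE. Qed.

Lemma consRV_tail (n : nat) (p : measurableTypeR R * borelRV R n)
    (i : 'I_1) (l : 'I_n) :
  (consRV p : 'rV[R]_(1 + n)) i (rshift 1 l) = (p.2 : 'rV[R]_n) i l.
Proof. by rewrite /consRV row_mxEr. Qed.

Lemma consRVK (n : nat) : cancel (@consRV n) (@unconsRV n).
Proof.
move=> [x v]; rewrite /unconsRV /consRV; congr pair; last by rewrite row_mxKr.
by rewrite row_mxEl mxE.
Qed.

Lemma measurable_open_RV (n : nat) (A : set 'rV[R]_n) :
  open A -> measurable (A : set (borelRV R n)).
Proof. by move=> oA; apply: sub_sigma_algebra. Qed.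

Lemma measurable_unconsRV (n : nat) : measurable_fun setT (@unconsRV n).
Proof.
apply: measurable_fun_pair.
  apply: (measurability (@RGenOInfty.G R)); first exact: RGenOInfty.measurableE.
  move=> _ [_ [x ->] <-]; rewrite setTI; apply: measurable_open_RV.
  apply: open_comp; last exact: interval_open.
  by move=> v _; exact: (@coord_continuous R 1 (1 + n) ord0 (lshift n ord0)).
apply: (@measurability _ _ _ (borelRV R n) _ _ (@open 'rV[R]_n)) => //.
move=> _ [A oA <-]; rewrite setTI; apply: measurable_open_RV.
by apply: open_comp => // v _; exact: (@continuous_rsubmx R 1 1 n).
Qed.

Lemma measurable_consRV (n : nat) : measurable_fun setT (@consRV n).
Proof.
apply: (@measurability _ _ _ (borelRV R n.+1) _ _ (@open 'rV[R]_n.+1)) => //.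
move=> _ [A oA <-]; rewrite setTI.
pose q' (q : rat * 'rV[rat]_n) : 'rV[R]_n := map_mx ratr q.2.
pose box (q : rat * 'rV[rat]_n * nat) : set (measurableTypeR R * borelRV R n) :=
  (ball (ratr q.1.1 : R) q.2.+1%:R^-1 : set R) `*` ball (q' q.1) q.2.+1%:R^-1.
pose D := [set q | box q `<=` @consRV n @^-1` A].
have -> : @consRV n @^-1` A = \bigcup_(q in D) box q.
  rewrite eqEsubset; split=> [[x v]|p [q Dq]]; last exact: Dq.
  move=> /= Ap; have /nbhs_ballP[e /= e0 eA] : nbhs (consRV (x, v)) A.
    exact: open_nbhs_nbhs.
  have e20 : 0 < e / 2 by rewrite divr_gt0.
  have [k [k0 ke]] : exists k : nat, (0 < k.+1%:R^-1 :> R) /\ k.+1%:R^-1 < e / 2.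
    have [k _ /(_ _ (leqnn _))/= kP] := near_infty_natSinv_lt (PosNum e20).
    by exists k; rewrite invr_gt0.
  have rat_near (y : R) : exists r : rat, `|ratr r - y| < k.+1%:R^-1.
    have : y - k.+1%:R^-1 < y + k.+1%:R^-1 by rewrite ltrD2l gtrN.
    move=> /rat_in_itvoo[r]; rewrite in_itv/= => /andP[r1 r2]; exists r.
    by rewrite ltr_distl r1 r2.
  have [r rx] := rat_near x.
  have /choice[w wv] := fun i => rat_near (v ord0 i).
  exists (r, \row_i w i, k) => /=; last first.
    split=> /=; first by rewrite /ball/=.
    split=> // i j; rewrite !ord1 !mxE.
    by have := wv j; rewrite /ball/=.
  move=> [y z]/= [/= yr zw]; apply: eA; split=> // i j.
  case: (@split_ordP 1 n j) => l ->.
    rewrite !consRV_head/=; move: yr; rewrite /ball/= => yr.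
    rewrite (splitr e) (le_lt_trans (ler_distD (ratr r) _ _))//.
    by rewrite ltrD// (lt_trans _ ke)// distrC.
  rewrite !consRV_tail/=; case: zw => _ /(_ i l); rewrite !mxE/= ord1.
  rewrite /ball/= => zw.
  rewrite (splitr e) (le_lt_trans (ler_distD (ratr (w l)) _ _))//.
  by rewrite ltrD// (lt_trans _ ke)// distrC.
rewrite bigcup_mkcond; apply: countable_bigcupT_measurable => // q.
case: ifPn => // _; apply: measurableX.
  by apply: open_measurable; apply: ball_open; rewrite invr_gt0.
by apply: measurable_open_RV; apply: ball_open; rewrite invr_gt0.
Qed.

Section Succ.
Variables (n : nat) (mu : {sigma_finite_measure set (borelRV R n) -> \bar R}).

Definition succ_leb : set (borelRV R n.+1) -> \bar R :=
  pushforward (@lebesgue_measure R \x mu)%E (@consRV n).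

Let succ_leb0 : succ_leb set0 = 0%E.
Proof. by rewrite /succ_leb /pushforward preimage_set0 measure0. Qed.

Let succ_leb_ge0 A : (0 <= succ_leb A)%E.
Proof. by rewrite /succ_leb /pushforward; exact: measure_ge0. Qed.

Let succ_leb_sigma_additive : semi_sigma_additive succ_leb.
Proof.
have mc := @measurable_consRV n.
exact: (@measure_semi_sigma_additive _ _ _ (pushforward _ _)).
Qed.

HB.instance Definition _ := isMeasure.Build _ _ _ succ_leb
  succ_leb0 succ_leb_ge0 succ_leb_sigma_additive.

Let succ_leb_sigma_finite : sigma_finite setT succ_leb.
Proof.
have /sigma_finiteP[F [TF ndF Foo]] := sigma_finiteT (@lebesgue_measure R).
have /sigma_finiteP[G [TG ndG Goo]] := sigma_finiteT mu.
exists (fun k => @unconsRV n @^-1` (F k `*` G k)).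
  rewrite -preimage_bigcup -[LHS](preimage_setT (@unconsRV n)).
  congr (_ @^-1` _); rewrite -setXTT TF TG predeqE => -[x y]; split.
    move=> [/= [i _ Fix] [k _ Gky]]; exists (maxn i k) => //; split.
    - by move: x Fix; exact/subsetPset/ndF/leq_maxl.
    - by move: y Gky; exact/subsetPset/ndG/leq_maxr.
  by move=> [i _ []/= ? ?]; split; exists i.
move=> k; have [mF Fk] := Foo k; have [mG Gk] := Goo k; split.
  rewrite -[X in measurable X]setTI; apply: measurable_unconsRV => //.
  exact: measurableX.
rewrite /succ_leb /pushforward -comp_preimage.
rewrite (_ : _ \o _ = id) ?preimage_id; last first.
  by apply/funext => p; exact: consRVK.
by rewrite product_measure1E// lte_mul_pinfty// ge0_fin_numE.
Qed.

HB.instance Definition _ := Measure_isSigmaFinite.Build _ _ _ succ_leb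
  succ_leb_sigma_finite.

End Succ.

(* Lebesgue measure on R^n, as the n-fold product of that of R. *)
Fixpoint leb (n : nat) : {sigma_finite_measure set (borelRV R n) -> \bar R} :=
  match n with
  | 0 => \d_((0 : 'rV[R]_0) : borelRV R 0)
  | k.+1 => succ_leb (leb k)
  end.

Lemma measurable_coordRV (n : nat) (i : 'I_n) :
  measurable_fun setT
    ((fun v : 'rV[R]_n => v ord0 i) : borelRV R n -> measurableTypeR R).
Proof.
apply: (measurability (@RGenOInfty.G R)); first exact: RGenOInfty.measurableE.
move=> _ [_ [x ->] <-]; rewrite setTI; apply: measurable_open_RV.
apply: open_comp; last exact: interval_open.
by move=> v _; exact: coord_continuous.
Qed.

Lemma leb_box (n : nat) (a b : 'I_n -> R) : (forall i, a i <= b i) ->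
  measurable ([set v : 'rV[R]_n | forall i, a i < v ord0 i <= b i]
    : set (borelRV R n)) /\
  leb n [set v : 'rV[R]_n | forall i, a i < v ord0 i <= b i]
    = (\prod_(i < n) (b i - a i))%:E.
Proof.
elim: n a b => [|n IH] a b ab.
  have -> : [set v : 'rV[R]_0 | forall i, a i < v ord0 i <= b i] = setT.
    by apply/seteqP; split=> // v _ [].
  by split; [exact: measurableT|rewrite /= diracT big_ord0].
have [mB vB] := IH (a \o lift ord0) (b \o lift ord0) (fun i => ab _).
split.
  have -> : [set v : 'rV[R]_n.+1 | forall i, a i < v ord0 i <= b i] =
      \big[setI/setT]_(i < n.+1) [set v : 'rV[R]_n.+1 | a i < v ord0 i <= b i].
    rewrite -bigcap_seq; apply/seteqP; split=> v /= H; first by move=> i _; exact: H.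
    by move=> i; apply: H; rewrite /= mem_index_enum.
  apply: bigsetI_measurable => i _; rewrite -[X in measurable X]setTI.
  exact: (measurable_coordRV i measurableT (measurable_itv `]a i, b i])).
rewrite /= /succ_leb /pushforward.
have -> : @consRV n @^-1` [set v : 'rV[R]_n.+1 | forall i, a i < v ord0 i <= b i]
    = (`]a ord0, b ord0]%classic : set R) `*`
      [set v : 'rV[R]_n | forall i, a (lift ord0 i) < v ord0 i <= b (lift ord0 i)].
  apply/seteqP; split=> -[x v] /=.
    move=> H; split=> [|i].
      have := H ord0; rewrite in_itv/=.
      have -> : ord0 = lshift n (ord0 : 'I_1) :> 'I_n.+1 by apply/val_inj.
      by rewrite consRV_head.
    have := H (lift ord0 i).
    have -> : lift ord0 i = rshift 1 i by apply/val_inj.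
    by rewrite consRV_tail.
  move=> [xab vab] i; have [l|l] := @split_ordP 1 n i => ->.
    rewrite consRV_head/= ord1; move: xab; rewrite in_itv/=.
    by have -> : ord0 = lshift n (0 : 'I_1) :> 'I_n.+1 by apply/val_inj.
  rewrite consRV_tail/=; have := vab l.
  by have -> : lift ord0 l = rshift 1 l by apply/val_inj.
rewrite product_measure1E// [in LHS]/= lebesgue_measure_itv/= lte_fin.
rewrite [X in (_ * X)%E]vB big_ord_recl EFinM; congr (_ * _)%E.
by case: ltgtP (ab ord0) => // ->; rewrite subrr.
Qed.

End LebesgueRV.

(* Carathéodory's construction from the gauge |B_n| (diam U / 2)^n, where |B_n|
   is the volume of the unit ball of R^n; meant for n > 0 (for n = 0 the gauge
   of the empty set would be 1 because 0 ^+ 0 = 1). *)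
Definition hausdorff_cover (R : realType) (d : nat) (delta : R)
    (A : set 'rV[R]_d) : set (nat -> set 'rV[R]_d) :=
  [set U | A `<=` \bigcup_k U k /\
           forall k, bounded_set (U k) /\ diam (U k) <= delta].

Definition hausdorff_pre (R : realType) (n d : nat) (delta : R)
    (A : set 'rV[R]_d) : \bar R :=
  ereal_inf [set (\sum_(k <oo)
      leb R n (eball (0 : 'rV[R]_n) 1) * ((diam (U k) / 2) ^+ n)%:E)%E
    | U in hausdorff_cover delta A].

Definition hausdorff (R : realType) (n d : nat) (A : set 'rV[R]_d) : \bar R :=
  ereal_sup [set hausdorff_pre n delta A | delta in [set e : R | 0 < e]].

Section Polyhedra.
Variables (R : realType) (d : nat).
Local Notation V := 'rV[R]_d.

Definition half_space (H : set V) : Prop :=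
  exists a : V, exists b : R, a != 0 /\ H = [set x | dotv a x <= b].

Definition hyperplane (H : set V) : Prop :=
  exists a : V, exists b : R, a != 0 /\ H = [set x | dotv a x = b].

(* Polyhedra may have empty interior, so that the subsets of a hyperplane are
   covered by the same definition. *)
Definition polyhedron (P : set V) : Prop :=
  bounded_set P /\
  exists F : set (set V), [/\ finite_set F, F `<=` half_space &
    P = \bigcap_(H in F) H].

Definition polyhedral (A : set V) : Prop :=
  exists F : set (set V), [/\ finite_set F, F `<=` polyhedron &
    closure A = closure (\bigcup_(P in F) P)].

(* Near each boundary point, Omega is the strict epigraph, in some direction e,
   of a Lipschitz function of the component orthogonal to e. *)
Definition lipschitz_domain (Omega : set V) : Prop :=
  forall p, boundary Omega p ->
    exists r : R, exists e : V, exists phi : V -> R, exists k : R,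
    [/\ 0 < r, enorm e = 1,
        forall x y, `|phi x - phi y| <= k * enorm (x - y) &
        Omega `&` eball p r =
        [set x | phi (x - dotv x e *: e) < dotv x e] `&` eball p r].

(* Open finite circular cone with vertex v, axis directed by the unit vector e,
   half-angle theta and radius rho. Two such cones are congruent if and only if
   they have the same half-angle and the same radius. *)
Definition cone (theta rho : R) (v e : V) : set V :=
  [set x | enorm (x - v) < rho /\ cos theta * enorm (x - v) < dotv (x - v) e].

Definition cone_condition (theta rho : R) (Omega : set V) : Prop :=
  forall x, closure Omega x ->
    exists2 e, enorm e = 1 & cone theta rho x e `<=` Omega.

Record polyhedral_domain (Omega : set V) : Prop := PolyhedralDomain {
  domain_open : open Omega ;
  domain_connected : connected Omega ;
  domain_bounded : bounded_set Omega ;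
  domain_polyhedral : polyhedral Omega ;
  domain_lipschitz : lipschitz_domain Omega }.

Record is_cell (Omega K : set V) : Prop := IsCell {
  cell_sub : K `<=` Omega ;
  cell_open : open K ;
  cell_connected : connected K ;
  cell_polyhedral : polyhedral K }.

Record is_face (s : set V) : Prop := IsFace {
  face_neq0 : s !=set0 ;
  face_relopen : exists H U, [/\ hyperplane H, open U & s = H `&` U] ;
  face_connected : connected s ;
  face_polyhedral : polyhedral s }.

(* [center] and [faces_of] are only meaningful on [cells]. *)
Record mesh (Omega : set V) := Mesh {
  cells : set (set V) ;
  faces : set (set V) ;
  center : set V -> V ;
  faces_of : set V -> set (set V) ;
  cells_finite : finite_set cells ;
  faces_finite : finite_set faces ;
  mesh_cell : forall K, cells K -> is_cell Omega K ;
  mesh_face : forall s, faces s -> is_face s ;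
  mesh_cover : closure Omega = \bigcup_(K in cells) closure K ;
  mesh_boundary : forall K, cells K ->
    boundary K = \bigcup_(s in faces_of K) closure s ;
  mesh_faces_disj : forall K s t, cells K -> faces_of K s -> faces_of K t ->
    s <> t -> hausdorff d.-1 (s `&` t) = 0%E ;
  mesh_faces : faces = \bigcup_(K in cells) faces_of K ;
  mesh_interface : forall K L, cells K -> cells L -> K <> L ->
    (hausdorff d.-1 (closure K `&` boundary L) = 0%E /\
     hausdorff d.-1 (boundary K `&` closure L) = 0%E) \/
    (faces_of K `&` faces_of L !=set0 /\
     closure K `&` closure L =
       \bigcup_(s in faces_of K `&` faces_of L) closure s) ;
  mesh_ext : forall K, cells K ->
    hausdorff d.-1 (closure K `&` boundary Omega) = 0%E \/
    closure K `&` boundary Omega =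
      \bigcup_(s in faces_of K `&`
                    [set t | faces t /\ t `<=` boundary Omega]) closure s ;
  mesh_center : forall K, cells K -> K (center K) }.

Section Mesh.
Variables (Omega : set V) (M : mesh Omega).

(* The set of cells being finite, this is a maximum. *)
Definition mesh_size : R := sup [set diam K | K in cells M].

Definition star_shaped (K B : set V) : Prop :=
  forall x y (t : R), B x -> K y -> 0 <= t <= 1 -> K ((1 - t) *: x + t *: y).

Definition regular_mesh (mu lambda : R) : Prop :=
  (forall K, cells M K -> star_shaped K (eball (center M K) (mu * mesh_size)))
  /\ (forall s, faces M s ->
    ((lambda ^+ d.-1 * mesh_size ^+ d.-1)%:E *
     hausdorff d.-1 (eball (0 : 'rV[R]_d.-1) 1) <= hausdorff d.-1 s)%E).

Definition separates (s : set V) (KL : set V * set V) : Prop :=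
  [/\ cells M KL.1, cells M KL.2, KL.1 <> KL.2,
      faces_of M KL.1 s & faces_of M KL.2 s].

Definition interior_faces : set (set V) :=
  [set s | faces M s /\ exists KL, separates s KL].

(* The two cells sharing an interior face are unique up to their order, on
   which the terms of the discrete gradient do not depend. *)
Definition adjacent (s : set V) : set V * set V :=
  xget (set0, set0) (separates s).

Definition pyramid (K s : set V) : set V :=
  [set x | exists y, exists2 t : R, s y /\ 0 < t < 1 &
    x = (1 - t) *: center M K + t *: y].

Definition diamond (s : set V) : set V :=
  interior (closure (pyramid (adjacent s).1 s `|` pyramid (adjacent s).2 s)).

Definition outward_normal (K s : set V) (n : V) : Prop :=
  [/\ enorm n = 1, forall x y, s x -> s y -> dotv n (x - y) = 0 &
      forall x, s x -> \forall t \near 0^'+, K (x - t *: n) /\ ~ K (x + t *: n)].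

Definition normal (K s : set V) : V := xget 0 (outward_normal K s).

(* Discrete functions are maps on all sets, of which only the values at the
   cells of the mesh matter. *)
Definition cellwise (u : set V -> R) (x : V) : R :=
  \sum_(K \in cells M) u K * \1_K x.

Definition norm01 (u : set V -> R) : \bar R :=
  (\int[leb R d]_(x in Omega) `|cellwise u x|%:E)%E.

Definition discrete_gradient (u : set V -> R) (x : V) : V :=
  \sum_(s \in interior_faces)
    (fine (hausdorff d.-1 s) * ((u (adjacent s).2 - u (adjacent s).1)
       / fine (hausdorff d (diamond s))) * \1_(diamond s) x)
    *: normal (adjacent s).1 s.

End Mesh.
End Polyhedra.

(* Main.v *)
From mathcomp Require Import all_boot all_order all_algebra.
From mathcomp Require Import all_classical all_reals all_analysis.
From mathcomp Require Import measurable_realfun.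
From mathcomp Require Import lra ring.
Require Import Defs.

(** The idea is to follow straight segments from [x]. Let [x] be in a cell, and
    [y] in the cone with vertex [x] given by the cone condition. The segment
    from [x] to [y] stays in the domain and, for almost all [y], it goes from a
    cell to another only through an interior face. For such a [y], |u|(x) is at
    most |u|(y) plus the sum of the jumps of [u] through the interior faces met
    by the segment ([segment_jump]). Averaging over [y] in a cube contained in
    the cone, of a size independent of [x], bounds |u|(x) by the L1 norm of [u]
    plus a sum over the interior faces of the jump times the measure of the
    shadow of the face, that is, essentially the solid angle under which the
    face is seen from [x].

    On the other hand, the integral of the gradient against the kernel is a sum
    over the same faces, since the diamonds are pairwise disjoint. The term of a
    face [s] is |s| times the jump, times the mean value of the kernel on the
    diamond of [s]. If the diamond is within a distance [A] of [x], this mean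
    value is at least [A ^- d.-1]; and |s| is at least of order [h ^+ d.-1],
    with a constant that depends on [lambda], where [h] is the mesh size. A face
    has diameter at most [h], so its shadow has a measure at most of order
    [(h / A) ^+ d.-1] when [A] is suitably chosen: of order [h] if [x] is near the face, and
    of the order of the distance from [x] to the face otherwise
    ([shadow_estimate]). Therefore each term of the first sum is bounded by the
    corresponding term of the second ([face_estimate]).

    Three points need care. First, a segment may pass from a cell to another
    through a set that is null in codimension one; the targets [y] for which
    this happens are negligible, because the small sets of a covering of such a
    null set cast shadows contained in thin tubes ([hnull_shadow]). The same
    lemma shows that an open piece of a hyperplane is not null, from which all
    the combinatorial properties of meshes follow: distinct cells are disjoint
    ([cells_disjoint]), a face belongs to at most two cells
    ([face_three_cells]), and diamonds are disjoint ([diamond_disjoint]). The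
    local tool is that, near a face, a star-shaped cell lies on one side of it
    ([face_local]). Secondly, the volume of a diamond in the discrete gradient
    is a Hausdorff measure, which is bounded by a multiple of the Lebesgue
    measure through a decomposition into dyadic cubes ([hausdorff_open_le]).
    Thirdly, the measures of the faces must be finite, which follows from
    explicit coverings of hyperplanes ([hyperplane_cover]). *)

Set Implicit Arguments.
Unset Strict Implicit.
Unset Printing Implicit Defensive.

Import Order.TTheory GRing.Theory Num.Theory.
Import numFieldNormedType.Exports.
Local Open Scope classical_set_scope.
Local Open Scope ring_scope.

(** * Euclidean norm *)

Section Euclidean.
Variables (R : realType) (n : nat).
Implicit Types x y z : 'rV[R]_n.

Lemma dotvC x y : dotv x y = dotv y x.
Proof. by apply: eq_bigr => i _; rewrite mulrC. Qed.

Lemma dotvDl x y z : dotv (x + y) z = dotv x z + dotv y z.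
Proof. by rewrite -big_split; apply: eq_bigr => i _; rewrite mxE mulrDl. Qed.

Lemma dotvZl a x z : dotv (a *: x) z = a * dotv x z.
Proof. by rewrite mulr_sumr; apply: eq_bigr => i _; rewrite mxE mulrA. Qed.

Lemma dotvNl x z : dotv (- x) z = - dotv x z.
Proof. by rewrite -scaleN1r dotvZl mulN1r. Qed.

Lemma dotvDr x y z : dotv z (x + y) = dotv z x + dotv z y.
Proof. by rewrite dotvC dotvDl !(dotvC z). Qed.

Lemma dotvZr a x z : dotv z (a *: x) = a * dotv z x.
Proof. by rewrite dotvC dotvZl dotvC. Qed.

Lemma dotvNr x z : dotv z (- x) = - dotv z x.
Proof. by rewrite dotvC dotvNl dotvC. Qed.

Definition dotvE := (dotvDl, dotvDr, dotvNl, dotvNr, dotvZl, dotvZr).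

Lemma dotv_ge0 x : 0 <= dotv x x.
Proof. by apply: sumr_ge0 => i _; rewrite -expr2 sqr_ge0. Qed.

Lemma dotv_eq0 x : (dotv x x == 0) = (x == 0).
Proof.
apply/eqP/eqP => [h|->]; last by rewrite /dotv big1// => i _; rewrite mxE mul0r.
apply/rowP => i; rewrite mxE.
apply/eqP; rewrite -sqrf_eq0; apply/eqP.
apply: (psumr_eq0P (P := xpredT) (F := fun j => x ord0 j ^+ 2)) => //.
by move=> j _; exact: sqr_ge0.
Qed.

Lemma enorm_ge0 x : 0 <= enorm x.
Proof. exact: sqrtr_ge0. Qed.
Hint Resolve enorm_ge0 : core.

Lemma enorm_sqr x : enorm x ^+ 2 = dotv x x.
Proof. by rewrite sqr_sqrtr ?dotv_ge0. Qed.

Lemma enorm_eq0 x : (enorm x == 0) = (x == 0).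
Proof. by rewrite -dotv_eq0 -enorm_sqr sqrf_eq0. Qed.

Lemma enorm_gt0 x : (0 < enorm x) = (x != 0).
Proof. by rewrite lt_def enorm_eq0 enorm_ge0 andbT. Qed.

Lemma enorm0 : enorm (0 : 'rV[R]_n) = 0.
Proof. by apply/eqP; rewrite enorm_eq0. Qed.

Lemma enormZ a x : enorm (a *: x) = `|a| * enorm x.
Proof.
by rewrite /enorm !dotvE mulrA -expr2 sqrtrM ?sqr_ge0// sqrtr_sqr.
Qed.

Lemma enormN x : enorm (- x) = enorm x.
Proof. by rewrite -scaleN1r enormZ normrN1 mul1r. Qed.

Lemma enormB x y : enorm (x - y) = enorm (y - x).
Proof. by rewrite -enormN opprB. Qed.

Lemma dotv_le x y : dotv x y <= enorm x * enorm y.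
Proof.
have [->|y0] := eqVneq y 0.
  by rewrite enorm0 mulr0 -(scale0r x) dotvZr mul0r.
have [->|x0] := eqVneq x 0.
  by rewrite enorm0 mul0r -(scale0r y) dotvZl mul0r.
rewrite -!enorm_gt0 in x0 y0.
have := dotv_ge0 (enorm y *: x - enorm x *: y).
rewrite !dotvE -!enorm_sqr (dotvC y x) => H.
have xy0 := mulr_gt0 x0 y0.
rewrite -(ler_pM2l xy0); lra.
Qed.

Lemma enormD x y : enorm (x + y) <= enorm x + enorm y.
Proof.
rewrite -(@ler_pXn2r _ 2)// ?nnegrE ?addr_ge0// enorm_sqr !dotvE sqrrD -!enorm_sqr.
have := dotv_le x y; rewrite (dotvC y x) => H.
set p := _ * _ in H *; set q := dotv x y in H *; lra.
Qed.

Lemma enorm_distD z x y : enorm (x - y) <= enorm (x - z) + enorm (z - y).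
Proof. by rewrite -[x - y](subrKA z) enormD. Qed.

Lemma ler_enorm_dist x y : enorm x - enorm y <= enorm (x - y).
Proof. by rewrite lerBlDr -{1}(subrK y x) enormD. Qed.

Lemma coord_le_enorm x i : `|x ord0 i| <= enorm x.
Proof.
rewrite -sqrtr_sqr ler_sqrt ?dotv_ge0// /dotv (bigD1 i)//= -expr2.
by rewrite lerDl sumr_ge0// => j _; rewrite -expr2 sqr_ge0.
Qed.

Lemma enorm_le_coord x r : (forall i, `|x ord0 i| <= r) ->
  enorm x <= n%:R * r.
Proof.
case: (posnP n) => [n0|n_gt0] xr.
  rewrite /enorm /dotv big1 ?sqrtr0 ?n0 ?mul0r//.
  by move=> i; have := ltn_ord i; rewrite [X in (_ < X)%N]n0.
have r0 : 0 <= r by apply: le_trans (xr (Ordinal n_gt0)).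
have nr : 0 <= n%:R * r :> R by rewrite mulr_ge0.
rewrite -[leRHS]ger0_norm// -sqrtr_sqr ler_sqrt ?sqr_ge0//.
apply: (@le_trans _ _ (\sum_(i < n) r ^+ 2)).
  apply: ler_sum => i _; rewrite -expr2 -real_normK ?num_real//.
  by rewrite lerXn2r ?nnegrE.
rewrite sumr_const card_ord exprMn -[leLHS]mulr_natl ler_wpM2r ?sqr_ge0//.
by rewrite -natrX ler_nat leq_pmulr.
Qed.

(** The topology comes from the maximum norm; this equivalence lets all the
    local arguments below use Euclidean balls only. *)
Lemma nbhs_eball (x : 'rV[R]_n) (A : set 'rV[R]_n) :
  nbhs x A <-> exists2 r : R, 0 < r & eball x r `<=` A.
Proof.
split=> [/nbhs_ballP[e /= e0 eA]|[r r0 rA]].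
  exists e => // y xy; apply: eA; split=> // i j; rewrite !ord1.
  rewrite /ball/= distrC; apply: le_lt_trans xy.
  by have := coord_le_enorm (y - x) j; rewrite !mxE.
apply/nbhs_ballP; have n0 : 0 < n.+1%:R :> R by [].
exists (r / n.+1%:R) => /=; first by rewrite divr_gt0.
move=> y [_ xy]; apply: rA; rewrite /eball/=.
apply: (@le_lt_trans _ _ (n%:R * (r / n.+1%:R))).
  apply: enorm_le_coord => i; have := xy ord0 i.
  by rewrite /ball/= distrC !mxE => /ltW.
by rewrite mulrC -mulrA gtr_pMr// mulrC ltr_pdivrMr// mul1r ltr_nat.
Qed.

Lemma eball_nbhs x r : 0 < r -> nbhs x (eball x r).
Proof. by move=> r0; apply/nbhs_eball; exists r. Qed.

Lemma lipschitz_eball_continuous (f : 'rV[R]_n -> R) (k : R) :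
  (forall x y, `|f x - f y| <= k * enorm (x - y)) -> continuous f.
Proof.
move=> fk x; apply/(@cvgrPdist_lt _ _ _ _ (nbhs_filter x)) => e e0.
have k0 : 0 < `|k| + 1 by rewrite ltr_wpDl.
apply/nbhs_eball; exists (e / (`|k| + 1)); first exact: divr_gt0.
move=> y; rewrite /eball/= ltr_pdivlMr// => xy.
apply: le_lt_trans (fk _ _) _; rewrite enormB; apply: le_lt_trans xy.
rewrite mulrC ler_wpM2l// (le_trans (ler_norm _))// lerDl//.
Qed.

Lemma enorm_dist_continuous x : continuous (fun y => enorm (y - x)).
Proof.
apply: (@lipschitz_eball_continuous _ 1) => y z; rewrite mul1r ler_norml.
have h1 := ler_enorm_dist (y - x) (z - x).
have h2 := ler_enorm_dist (z - x) (y - x).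
rewrite !opprB !addrA !subrK in h1 h2; rewrite (enormB z y) in h2; lra.
Qed.

Lemma dotv_continuous x : continuous (dotv x).
Proof.
apply: (@lipschitz_eball_continuous _ (enorm x)) => y z.
rewrite -dotvNr -dotvDr ler_norml dotv_le andbT lerNl -dotvNr.
by rewrite (le_trans (dotv_le _ _))// enormN.
Qed.

Lemma open_eball x r : open (eball x r).
Proof.
rewrite (_ : eball x r = (fun y => enorm (y - x)) @^-1` [set t | t < r])//.
apply: open_comp; last exact: open_lt.
by move=> y _; exact: enorm_dist_continuous.
Qed.

Lemma bounded_eball (A : set 'rV[R]_n) :
  bounded_set A <-> exists M : R, forall x, A x -> enorm x <= M.
Proof.
split=> [[M [_ HM]]|[M HM]].
  have H : forall x, A x -> `|x| <= M + 1 by apply: HM; rewrite ltrDl.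
  exists (n%:R * (M + 1)) => x /H xM; apply: enorm_le_coord => i.
  apply: le_trans xM; rewrite [leRHS]mx_normrE.
  exact: (le_bigmax _ (fun ij => `|x ij.1 ij.2|) (ord0, i)).
exists `|M|; split; first exact: num_real.
move=> r Mr x /HM xM.
change (`|x| <= r); rewrite [leLHS]mx_normrE; apply/bigmax_leP; split=> [|[i j] _ /=].
  by rewrite (le_trans _ (ltW Mr)).
by rewrite ord1 (le_trans (coord_le_enorm x j))// (le_trans xM)// (le_trans (ler_norm M))// ltW.
Qed.

Lemma diam_set_ubound (A : set 'rV[R]_n) : bounded_set A ->
  has_ubound [set t | exists x y, [/\ A x, A y & t = enorm (x - y)]].
Proof.
move=> /bounded_eball[M AM]; exists (M + M) => t [x [y [Ax Ay ->]]].
by rewrite (le_trans (enormD _ _))// enormN lerD// AM.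
Qed.

Lemma enorm_le_diam (A : set 'rV[R]_n) x y :
  bounded_set A -> A x -> A y -> enorm (x - y) <= diam A.
Proof.
by move=> /diam_set_ubound bA Ax Ay; apply: ub_le_sup => //; exists x, y.
Qed.

Lemma diam_le (A : set 'rV[R]_n) r : 0 <= r ->
  (forall x y, A x -> A y -> enorm (x - y) <= r) -> diam A <= r.
Proof.
move=> r0 Ar; rewrite /diam; have [->|/set0P A0] := eqVneq A set0.
  rewrite (_ : mkset _ = set0) ?sup0//.
  by apply/seteqP; split=> // t [x [y []]].
case: A0 => a Aa; apply: ge_sup; first by exists 0, a, a; rewrite subrr enorm0.
by move=> t [x [y [Ax Ay ->]]]; exact: Ar.
Qed.

Lemma diam_ge0 (A : set 'rV[R]_n) : bounded_set A -> 0 <= diam A.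
Proof.
move=> bA; have [->|/set0P[a Aa]] := eqVneq A set0.
  rewrite /diam (_ : mkset _ = set0) ?sup0//.
  by apply/seteqP; split=> // t [x [y []]].
by rewrite (le_trans (enorm_ge0 (a - a)))// enorm_le_diam.
Qed.

Lemma diam_set0 : diam (set0 : set 'rV[R]_n) = 0.
Proof.
rewrite /diam (_ : mkset _ = set0) ?sup0//.
by apply/seteqP; split=> // t [x [y []]].
Qed.

Lemma closure_eball (A : set 'rV[R]_n) x : closure A x ->
  forall e, 0 < e -> exists2 y, A y & enorm (y - x) < e.
Proof.
by move=> cAx e e0; have [y [Ay xy]] := cAx _ (eball_nbhs x e0); exists y.
Qed.

Lemma closure_dist_le (A : set 'rV[R]_n) r :
  (forall x y, A x -> A y -> enorm (x - y) <= r) ->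
  forall x y, closure A x -> closure A y -> enorm (x - y) <= r.
Proof.
move=> Ar x y cx cy; apply/ler_addgt0Pl => e e0.
have e2 : 0 < e / 2 by rewrite divr_gt0.
have [x' Ax' xx'] := closure_eball cx e2.
have [y' Ay' yy'] := closure_eball cy e2.
have := enorm_distD x' x y; have := enorm_distD y' x' y; have := Ar _ _ Ax' Ay'.
rewrite (enormB x x'); lra.
Qed.

End Euclidean.
#[global] Hint Resolve enorm_ge0 : core.

(** * Cubes, tubes and shadows *)

Section Covering.
Variables (R : realType) (n : nat).
Implicit Types x y z : 'rV[R]_n.
Local Notation V := 'rV[R]_n.

(** Half-open, so that its measure is given by [leb_box]. *)
Definition cube (c : V) (r : R) : set V :=
  [set v | forall i, c ord0 i - r < v ord0 i <= c ord0 i + r].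

Lemma measurable_cube c r : 0 <= r -> measurable (cube c r : set (borelRV R n)).
Proof.
move=> r0; apply: (leb_box (a := fun i => c ord0 i - r) _).1 => i /=.
by rewrite lerD2l (le_trans _ r0)// oppr_le0.
Qed.

Lemma leb_cube c r : 0 <= r -> leb R n (cube c r) = ((2 * r) ^+ n)%:E.
Proof.
move=> r0; rewrite (leb_box (a := fun i => c ord0 i - r)
  (b := fun i => c ord0 i + r) _).2; last first.
  by move=> i; rewrite lerD2l (le_trans _ r0)// oppr_le0.
rewrite (eq_bigr (fun=> 2 * r)); last first.
  by move=> i _; rewrite opprB addrC addrA subrK mulr2n mulrDl mul1r.
by rewrite prodr_const card_ord.
Qed.

Lemma eball_sub_cube c r : eball c r `<=` cube c r.
Proof.
move=> x cx i; have := coord_le_enorm (x - c) i; rewrite !mxE => h.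
have : `|x ord0 i - c ord0 i| < r by exact: le_lt_trans cx.
rewrite ltr_norml => /andP[h1 h2]; apply/andP; split; lra.
Qed.

Lemma cube_sub_eball c r : 0 < r -> cube c (r / n.+1%:R) `<=` eball c r.
Proof.
move=> r0 x cx; have n0 : 0 < n.+1%:R :> R by [].
apply: (@le_lt_trans _ _ (n%:R * (r / n.+1%:R))).
  apply: enorm_le_coord => i; have /andP[] := cx i; rewrite !mxE.
  move: (r / _) => e h1 h2.
  by rewrite ler_norml; apply/andP; split; lra.
by rewrite mulrC -mulrA gtr_pMr// mulrC ltr_pdivrMr// mul1r ltr_nat.
Qed.

Lemma measurable_eball c r : measurable (eball c r : set (borelRV R n)).
Proof. by apply: measurable_open_RV; exact: open_eball. Qed.

Lemma leb_eball_gt0 c r : 0 < r -> (0 < leb R n (eball c r))%E.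
Proof.
move=> r0; have nr : 0 < r / n.+1%:R by rewrite divr_gt0.
apply: (@lt_le_trans _ _ (leb R n (cube c (r / n.+1%:R)))).
  by rewrite leb_cube ?(ltW nr)// lte_fin exprn_gt0// mulr_gt0.
apply: le_measure; rewrite ?inE.
- exact: measurable_cube (ltW nr).
- exact: measurable_eball.
- exact: cube_sub_eball.
Qed.

Lemma not_negligible_open (A : set V) : open A -> A !=set0 ->
  ~ (leb R n).-negligible A.
Proof.
move=> oA [x Ax] [B [mB B0 AB]].
have /nbhs_eball[r r0 rA] : nbhs x A by exact: open_nbhs_nbhs.
have := leb_eball_gt0 x r0; rewrite ltNge => /negP; apply; rewrite -B0.
apply: le_measure; rewrite ?inE//; first exact: measurable_eball.
exact: subset_trans rA AB.
Qed.

(** The witness is the intersection of measurable supersets of measure at most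
    [k.+1%:R^-1]. *)
Lemma negligible_small (A : set V) :
  (forall e : R, 0 < e -> exists T : set V,
    [/\ measurable (T : set (borelRV R n)), A `<=` T & (leb R n T <= e%:E)%E]) ->
  (leb R n).-negligible A.
Proof.
move=> H.
have /choice[T HT] : forall k : nat, exists T : set V,
    [/\ measurable (T : set (borelRV R n)), A `<=` T &
      (leb R n T <= (k.+1%:R^-1)%:E)%E].
  by move=> k; apply: H; rewrite invr_gt0.
have mT : measurable (\bigcap_k T k : set (borelRV R n)).
  by apply: bigcapT_measurable => k; have [] := HT k.
exists (\bigcap_k T k); split => //; last by move=> x Ax k _; have [_ + _] := HT k; apply.
apply/eqP; rewrite eq_le measure_ge0 andbT; apply/lee_addgt0Pr => e e0.
have [k] := ltr_add_invr e0; rewrite add0r => ke.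
have [mTk _ Tk] := HT k; rewrite add0e.
apply: (@le_trans _ _ (leb R n (T k))).
  by apply: le_measure; rewrite ?inE//; move=> x; exact.
by apply: le_trans Tk _; rewrite lee_fin ltW.
Qed.

(** A segment of length at most [L], thickened by [r], is covered by the cubes
    of half-side [3 * r] around points of the segment spaced by at most [r]. *)
Lemma tube_cover (p v : V) (r L : R) : 0 < r -> enorm v <= L ->
  exists T : set V, [/\ measurable (T : set (borelRV R n)),
    [set z | exists2 s : R, 0 <= s <= 1 & enorm (z - (p + s *: v)) <= r] `<=` T &
    (leb R n T <= ((L / r + 2) * (6 * r) ^+ n)%:E)%E].
Proof.
move=> r0 vL; have L0 : 0 <= L := le_trans (enorm_ge0 _) vL.
have Lr0 : 0 <= L / r by rewrite divr_ge0// ltW.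
pose N := (Num.trunc (L / r)).+1.
have /andP[N1 N2] := truncn_itv Lr0; rewrite -/N in N2.
have N0 : 0 < N%:R :> R by rewrite ltr0n.
have r3 : 0 <= 3 * r by rewrite mulr_ge0// ltW.
pose C k := cube (p + (k%:R / N%:R) *: v) (3 * r).
exists (\big[setU/set0]_(k < N.+1) C k); split.
- by apply: bigsetU_measurable => k _; exact: measurable_cube.
- move=> z [s /andP[s0 s1] zs].
  have sN0 : 0 <= s * N%:R by rewrite mulr_ge0// ltW.
  have /andP[k1 k2] := truncn_itv sN0; set k := Num.trunc _ in k1 k2.
  have kN : (k < N.+1)%N.
    by rewrite ltnS -(ler_nat R) (le_trans k1)// ler_piMl// ltW.
  rewrite -(bigcup_mkord _ C); exists k => //; apply: eball_sub_cube.
  rewrite /eball/=; apply: le_lt_trans (enorm_distD (p + s *: v) _ _) _.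
  have -> : p + s *: v - (p + (k%:R / N%:R) *: v) = (s - k%:R / N%:R) *: v.
    by rewrite opprD addrACA subrr add0r -scalerBl.
  rewrite enormZ.
  have sk : `|s - k%:R / N%:R| * N%:R <= 1.
    rewrite -[X in _ * X](gtr0_norm N0) -normrM mulrBl divfK ?gt_eqF//.
    rewrite ger0_norm ?subr_ge0// lerBlDr addrC; apply/ltW.
    by rewrite -natr1 in k2.
  have vN : enorm v <= N%:R * r.
    by rewrite (le_trans vL)// -ler_pdivrMr// ltW.
  have : `|s - k%:R / N%:R| * enorm v <= r.
    apply: (@le_trans _ _ (`|s - k%:R / N%:R| * N%:R * r)).
      by rewrite -mulrA ler_wpM2l.
    by rewrite ler_piMl// ltW.
  lra.
- apply: (le_trans (Boole_inequality _ _)).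
    by move=> k _; exact: measurable_cube.
  rewrite (eq_bigr (fun=> ((2 * (3 * r)) ^+ n)%:E)); last first.
    by move=> k _; exact: leb_cube.
  rewrite sumEFin lee_fin sumr_const card_ord -[leLHS]mulr_natl mulrA.
  rewrite (_ : 2 * 3 = 6 :> R); last by lra.
  rewrite ler_wpM2r ?exprn_ge0//; first by rewrite mulr_ge0// ltW.
  rewrite -natr1 /N -natr1 -addrA -[1 + 1]/2 lerD2r; exact: N1.
Qed.

(** The measure of the shadow inside a ball centred at [x] plays the part of the
    solid angle under which [U] is seen from [x]. *)
Definition shadow (x : V) (U : set V) : set V :=
  [set y | exists2 t : R, 0 <= t <= 1 & U (x + t *: (y - x))].

(** A point of the shadow in the ball is [x + s *: (q - x)] with [q] in [U] and
    [s <= rho / r0], hence it is within [rho / r0 * dl] of a point of the segment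
    issued from [x] through [q0]: the shadow lies in a tube, whose measure is of
    order [dl ^+ n.-1]. *)
Lemma shadow_cover (x q0 : V) (U : set V) (rho r0 M dl : R) :
  0 < r0 -> 0 < dl -> 0 < rho ->
  (forall q, U q -> r0 <= enorm (q - x)) ->
  (forall q, U q -> enorm (q - q0) <= dl) -> enorm (q0 - x) <= M ->
  exists T : set V, [/\ measurable (T : set (borelRV R n)),
    shadow x U `&` [set y | enorm (y - x) <= rho] `<=` T &
    (leb R n T <= ((M / dl + 2) * (6 * (rho / r0 * dl)) ^+ n)%:E)%E].
Proof.
move=> r00 dl0 rho0 Ur0 Udl q0M; pose S := rho / r0.
have S0 : 0 < S by rewrite divr_gt0.
have Sdl : 0 < S * dl by rewrite mulr_gt0.
have vM : enorm (S *: (q0 - x)) <= S * M by rewrite enormZ gtr0_norm// ler_pM2l.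
have [T [mT tubeT TM]] := tube_cover x Sdl vM; exists T; split => //.
  move=> y [[t /andP[t0 t1] Uq] /= yrho]; set q := _ + _ in Uq.
  have qx : q - x = t *: (y - x) by rewrite /q addrC addKr.
  have := Ur0 _ Uq; rewrite qx enormZ ger0_norm// => r0q.
  have tn0 : 0 < t.
    rewrite lt_def t0 andbT; apply/eqP => t00; move: r0q.
    by rewrite t00 mul0r leNgt r00.
  have tS : t^-1 <= S.
    rewrite -div1r ler_pdivrMr// /S mulrAC ler_pdivlMr// mul1r (le_trans r0q)//.
    by rewrite mulrC ler_pM2r.
  apply: tubeT; exists (t^-1 / S).
    by rewrite divr_ge0 ?invr_ge0//= ?ler_pdivrMr ?mul1r// ltW.
  rewrite scalerA divfK ?gt_eqF//.
  have -> : y - (x + t^-1 *: (q0 - x)) = t^-1 *: (q - q0).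
    rewrite -[q - q0](subrKA x) qx [RHS]scalerDr scalerA mulVf ?gt_eqF// scale1r.
    by rewrite -[x - q0]opprB scalerN opprD addrA.
  rewrite enormZ gtr0_norm ?invr_gt0// ler_pM ?invr_ge0//.
  - exact: enorm_ge0.
  - exact: Udl.
by rewrite -mulf_div divff ?mul1r ?gt_eqF// in TM.
Qed.

End Covering.

(** * Null sets for the Hausdorff measures *)

Section HausdorffNull.
Variable R : realType.

Lemma leb_unit_ball_ge (n : nat) :
  (((2 / n.+1%:R) ^+ n)%:E <= leb R n (eball (0 : 'rV[R]_n) 1))%E.
Proof.
have n0 : 0 <= 1 / n.+1%:R :> R by rewrite divr_ge0.
rewrite (_ : 2 / n.+1%:R = 2 * (1 / n.+1%:R)); last by rewrite div1r.
rewrite -(leb_cube 0 n0).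
apply: le_measure; rewrite ?inE.
- exact: measurable_cube.
- exact: measurable_eball.
- exact: cube_sub_eball.
Qed.

(** Vanishing [n]-dimensional Hausdorff measure in terms of coverings by sets of
    positive size, so that the bounds on tubes and cubes apply to them. *)
Definition hnull (n d : nat) (A : set 'rV[R]_d) : Prop :=
  forall e : R, 0 < e -> exists (U : nat -> set 'rV[R]_d) (r : nat -> R),
    [/\ A `<=` \bigcup_k U k, forall k, 0 < r k <= 1,
        forall k x y, U k x -> U k y -> enorm (x - y) <= r k &
        (\sum_(0 <= k <oo) (r k ^+ n)%:E <= e%:E)%E].

Lemma hnull_sub (n d : nat) (A B : set 'rV[R]_d) :
  A `<=` B -> hnull n B -> hnull n A.
Proof.
move=> AB nB e /nB[U [r [BU r0 Ur sr]]]; exists U, r; split=> //.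
exact: subset_trans AB BU.
Qed.

(** The sizes of the sets of an almost optimal covering are made positive by
    raising them to the terms of a geometric series of small sum. *)
Lemma hausdorff_eq0_hnull (n d : nat) (A : set 'rV[R]_d) : (0 < n)%N ->
  hausdorff n A = 0%E -> hnull n A.
Proof.
move=> n0 A0 e e0.
pose w : R := (2 / n.+1%:R) ^+ n; have w0 : 0 < w by rewrite exprn_gt0// divr_gt0.
have w2 : 0 < w / 2 ^+ n by rewrite divr_gt0// exprn_gt0.
pose e' := e / 2 * (w / 2 ^+ n).
have e20 : 0 < e / 2 by rewrite divr_gt0.
have e'0 : 0 < e' by rewrite mulr_gt0.
have : (hausdorff_pre n 1 A < e'%:E)%E.
  apply: (@le_lt_trans _ _ 0%E); last by rewrite lte_fin.
  by rewrite -A0; apply: ereal_sup_ubound; exists 1 => /=.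
move=> /ereal_inf_lt[_ [U [AU Ub] <-] sU].
pose eta (k : nat) : R := Num.min 1 (e / 2 / (2 ^ k.+1)%:R).
have eta0 k : 0 < eta k by rewrite lt_min ltr01/= divr_gt0// ltr0n expn_gt0.
pose r k := Num.max (diam (U k)) (eta k).
have r01 k : 0 < r k <= 1.
  rewrite lt_max eta0 orbT/= ge_max ge_min lexx/= andbT.
  by have [_] := Ub k.
exists U, r; split => //.
  move=> k x y Ux Uy; rewrite le_max; apply/orP; left; apply: enorm_le_diam => //.
  by have [] := Ub k.
have dU k : 0 <= diam (U k) by apply: diam_ge0; have [] := Ub k.
have -> : e%:E = ((e / 2)%:E + (e / 2)%:E)%E by rewrite -EFinD -splitr.
apply: (@le_trans _ _ (\sum_(0 <= k <oo) ((diam (U k) ^+ n)%:E +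
    (e / 2 / (2 ^ k.+1)%:R)%:E))%E).
  apply: lee_nneseries => k _.
    by rewrite lee_fin exprn_ge0//; have /andP[/ltW] := r01 k.
  rewrite -EFinD lee_fin /r; case: (leP (diam (U k)) (eta k)) => _.
    apply: (@le_trans _ _ (eta k)); last first.
      rewrite /eta (@le_trans _ _ (e / 2 / (2 ^ k.+1)%:R))//.
        by rewrite ge_min lexx orbT.
      by rewrite lerDr exprn_ge0.
    by rewrite -[leRHS]expr1 ler_wiXn2l ?(ltW (eta0 k))// /eta ge_min lexx.
  by rewrite lerDl divr_ge0// ltW.
apply: (le_trans (epsilon_trick _ _ _)).
- by move=> k; rewrite lee_fin exprn_ge0.
- exact: ltW.
have w2E : (0 < (w / 2 ^+ n)%:E)%E by rewrite lte_fin.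
rewrite leeD2r// -(lee_pmul2l _ w2E)//.
rewrite -nneseriesZl; last by move=> k _; rewrite lee_fin exprn_ge0.
rewrite -EFinM (mulrC _ (e / 2)) -/e'; apply: le_trans (ltW sU).
apply: lee_nneseries => k _; first by rewrite -EFinM lee_fin mulr_ge0 ?exprn_ge0// ltW.
apply: (@le_trans _ _ (w%:E * ((diam (U k) / 2) ^+ n)%:E)%E).
  by rewrite -!EFinM lee_fin expr_div_n mulrAC mulrA.
apply: lee_wpmul2r; last exact: leb_unit_ball_ge.
by rewrite lee_fin exprn_ge0// divr_ge0.
Qed.

(** In full dimension, a set of diameter [r k] lies in a cube of measure
    [(4 * r k) ^+ n]. *)
Lemma hnull_leb (n : nat) (A : set 'rV[R]_n) :
  hnull n A -> (leb R n).-negligible A.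
Proof.
move=> nA; apply: negligible_small => e e0.
have e4 : 0 < e / 4 ^+ n by rewrite divr_gt0// exprn_gt0.
have [U [r [AU r01 Ur sr]]] := nA _ e4.
have r0 k : 0 <= 2 * r k.
  by have /andP[/ltW ? _] := r01 k; rewrite mulr_ge0.
have /choice[T HT] : forall k, exists T : set 'rV[R]_n,
    [/\ measurable (T : set (borelRV R n)), U k `<=` T &
     (leb R n T <= (4 ^+ n)%:E * (r k ^+ n)%:E)%E].
  move=> k; have [U0|/set0P[c Uc]] := eqVneq (U k) set0.
    exists set0; rewrite U0 measure0; split => //.
    have /andP[/ltW ? _] := r01 k.
    by rewrite -EFinM lee_fin mulr_ge0 ?exprn_ge0.
  exists (cube c (2 * r k)); split; first exact: measurable_cube.
    move=> x Ux; apply: eball_sub_cube; apply: (le_lt_trans (Ur k _ _ Ux Uc)).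
    by have /andP[? _] := r01 k; rewrite ltr_pMl// ltr1n.
  rewrite leb_cube// -EFinM lee_fin -exprMn mulrA.
  by rewrite (_ : 2 * 2 = 4 :> R)//; lra.
exists (\bigcup_k T k); split.
- by apply: bigcupT_measurable => k; have [] := HT k.
- by move=> x /AU[k _ Ux]; exists k => //; have [_ + _] := HT k; apply.
have mT : forall k, measurable (T k : set (borelRV R n)) by move=> k; have [] := HT k.
apply: (le_trans (measure_sigma_subadditive (leb R n) mT
   (bigcupT_measurable _ mT) (@subset_refl _ _))).
apply: (@le_trans _ _ (\sum_(0 <= k <oo) (4 ^+ n)%:E * (r k ^+ n)%:E)%E).
  by apply: lee_nneseries => // k _; have [] := HT k.
rewrite nneseriesZl; last first.
  by move=> k _; rewrite lee_fin exprn_ge0//; have /andP[/ltW] := r01 k.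
rewrite (le_trans (lee_wpmul2l _ sr))// ?lee_fin ?exprn_ge0//.
by rewrite mulrC divfK// expf_eq0 pnatr_eq0 andbF.
Qed.

(** Seen from a point at positive distance, a set that is negligible in
    codimension one casts a Lebesgue negligible shadow: each set of the
    covering casts a shadow contained in a thin tube. *)
Lemma hnull_shadow (n : nat) (N : set 'rV[R]_n.+1) x rho r0 :
  hnull n N -> bounded_set N -> 0 < r0 -> (forall q, N q -> r0 <= enorm (q - x)) ->
  (leb R n.+1).-negligible (shadow x N `&` [set y | enorm (y - x) <= rho]).
Proof.
move=> nN bN r00 Nr0; have [M0 NM0] := (bounded_eball N).1 bN.
wlog rho0 : rho / 0 < rho.
  have r1 : 0 < `|rho| + 1 by rewrite ltr_wpDl.
  move=> /(_ _ r1); apply: negligibleS => y [? /= yr]; split => //=.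
  by have := ler_norm rho; lra.
pose M := `|M0| + enorm x.
have NM q : N q -> enorm (q - x) <= M.
  move=> /NM0 qM; rewrite (le_trans (enormD _ _))// enormN lerD2r.
  by rewrite (le_trans qM)// ler_norm.
have M_ge0 : 0 <= M by rewrite addr_ge0 ?enorm_ge0.
pose S := rho / r0; have S0 : 0 < S by rewrite divr_gt0.
pose K := (M + 2) * (6 * S) ^+ n.+1.
have K0 : 0 < K by rewrite mulr_gt0// ?ltr_wpDl// exprn_gt0// mulr_gt0.
apply: negligible_small => e e0.
have [U [r [NU r01 Ur sr]]] := nN _ (divr_gt0 e0 K0).
have r_gt0 k : 0 < r k by have /andP[] := r01 k.
have /choice[T HT] : forall k, exists T : set 'rV[R]_n.+1,
    [/\ measurable (T : set (borelRV R n.+1)),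
     shadow x (U k `&` N) `&` [set y | enorm (y - x) <= rho] `<=` T &
     (leb R n.+1 T <= K%:E * (r k ^+ n)%:E)%E].
  move=> k; have [U0|/set0P[q0 [Uq0 Nq0]]] := eqVneq (U k `&` N) set0.
    exists set0; rewrite U0 measure0; split => //.
      by move=> y [[t ? []]].
    by rewrite -EFinM lee_fin mulr_ge0 ?exprn_ge0// ltW.
  have [||T [mT ST TM]] := @shadow_cover _ _ x q0 (U k `&` N) rho r0 M (r k)
    r00 (r_gt0 k) rho0 _ _ (NM _ Nq0).
  - by move=> q [_ /Nr0].
  - by move=> q [Uq _]; exact: Ur.
  exists T; split => //; apply: (le_trans TM); rewrite -EFinM lee_fin -/S.
  have rk := r_gt0 k; have /andP[_ rk1] := r01 k.
  have -> : (6 * (S * r k)) ^+ n.+1 = (6 * S) ^+ n.+1 * (r k * r k ^+ n).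
    by rewrite mulrA exprMn -exprS.
  rewrite [leLHS](_ : _ = (M + 2 * r k) * (6 * S) ^+ n.+1 * r k ^+ n); last first.
    have -> : M + 2 * r k = (M / r k + 2) * r k.
      by rewrite [RHS]mulrDl divfK// gt_eqF.
    ring.
  rewrite ler_wpM2r ?exprn_ge0 ?(ltW rk)//.
  have rM : M + 2 * r k <= M + 2 by lra.
  by rewrite ler_wpM2r// exprn_ge0// mulr_ge0// ltW.
exists (\bigcup_k T k); split.
- by apply: bigcupT_measurable => k; have [] := HT k.
- move=> y [[t t01 Nq] yrho]; have [k _ Uq] := NU _ Nq; exists k => //.
  by have [_ + _] := HT k; apply; split => //; exists t.
have mT : forall k, measurable (T k : set (borelRV R n.+1)) by move=> k; have [] := HT k.
apply: (le_trans (measure_sigma_subadditive (leb R n.+1) mT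
   (bigcupT_measurable _ mT) (@subset_refl _ _))).
apply: (@le_trans _ _ (\sum_(0 <= k <oo) K%:E * (r k ^+ n)%:E)%E).
  by apply: lee_nneseries => // k _; have [] := HT k.
rewrite nneseriesZl; last by move=> k _; rewrite lee_fin exprn_ge0// ltW.
have K0' : (0 <= K%:E)%E by rewrite lee_fin ltW.
by rewrite (le_trans (lee_wpmul2l K0' sr))// -EFinM lee_fin mulrC divfK// gt_eqF.
Qed.

End HausdorffNull.

(** * Star-shaped sets near their faces *)

Section Radial.
Variables (R : realType) (n : nat).
Local Notation V := 'rV[R]_n.
Implicit Types (a c y z : V) (b : R).

(** Projection from [c], along rays, onto the hyperplane of equation
    [dotv a x = b]. *)
Definition rayproj c a b z : V :=
  c + ((b - dotv a c) / dotv a (z - c)) *: (z - c).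

Lemma dotv_rayproj c a b z : dotv a (z - c) != 0 -> dotv a (rayproj c a b z) = b.
Proof. by move=> h; rewrite /rayproj dotvDr dotvZr divfK// addrC subrK. Qed.

Lemma rayproj_id c a b z : dotv a z = b -> dotv a c != b -> rayproj c a b z = z.
Proof.
move=> azb acb; have bac : b - dotv a c != 0 by rewrite subr_eq0 eq_sym.
by rewrite /rayproj dotvDr dotvNr azb divff// scale1r addrC subrK.
Qed.

Lemma rayprojP c a b z : dotv a c != b -> dotv a (z - c) != 0 ->
  z = c + (dotv a (z - c) / (b - dotv a c)) *: (rayproj c a b z - c).
Proof.
move=> acb azc; rewrite /rayproj [c + _ - c]addrC addKr scalerA.
have bac : b - dotv a c != 0 by rewrite subr_eq0 eq_sym.
by rewrite mulrA divfK// divff// scale1r addrC subrK.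
Qed.

Lemma dotv_gt_nbhs a b z : b < dotv a z -> nbhs z [set y | b < dotv a y].
Proof.
move=> h; apply: (@dotv_continuous _ _ a z [set t | b < t]).
by apply: open_nbhs_nbhs; split=> //; exact: open_gt.
Qed.

Lemma dotv_lt_nbhs a b z : dotv a z < b -> nbhs z [set y | dotv a y < b].
Proof.
move=> h; apply: (@dotv_continuous _ _ a z [set t | t < b]).
by apply: open_nbhs_nbhs; split=> //; exact: open_lt.
Qed.

Lemma rayproj_nbhs c a b z (U : set V) : dotv a (z - c) != 0 ->
  nbhs (rayproj c a b z) U -> nbhs z (rayproj c a b @^-1` U).
Proof.
move=> azc Unb; suff H : rayproj c a b y @[y --> z] --> rayproj c a b z by exact: H.
have Fz := nbhs_filter z.
have zc : (y - c) @[y --> z] --> z - c.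
  by apply: (@cvgB _ _ _ (nbhs z) Fz); [exact: cvg_id|exact: cvg_cst].
apply: (@cvgD _ _ _ (nbhs z) Fz); first exact: cvg_cst.
apply: (@cvgZ _ _ _ (nbhs z) Fz) => //.
apply: (@cvgM _ _ (nbhs z) Fz); first exact: cvg_cst.
apply: (@cvgV _ _ (nbhs z) Fz) => //.
have -> : (fun y : V => dotv a (y - c)) = (fun y => dotv a y - dotv a c).
  by apply/funext => y; rewrite dotvDr dotvNr.
rewrite dotvDr dotvNr.
by apply: (@cvgB _ _ _ (nbhs z) Fz); [exact: dotv_continuous|exact: cvg_cst].
Qed.

Lemma open_segment (A : set V) y v : nbhs y A ->
  exists2 t : R, 0 < t & A (y + t *: v).
Proof.
move=> /nbhs_eball[e e0 eA]; exists (e / (enorm v + 1)).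
  by rewrite divr_gt0// ltr_wpDl ?enorm_ge0.
have v1 : 0 < enorm v + 1 by rewrite ltr_wpDl ?enorm_ge0.
apply: eA; rewrite /eball/= addrC addKr enormZ gtr0_norm ?divr_gt0//.
by rewrite mulrAC ltr_pdivrMr// ltr_pM2l// ltrDl.
Qed.

End Radial.

(** The shadow of a hyperplane piece seen from a point off the hyperplane
    contains an open set. *)
Lemma hyperplane_open_not_hnull (R : realType) (n : nat) (a : 'rV[R]_n.+1) (b : R)
    (U : set 'rV[R]_n.+1) : a != 0 -> open U ->
  ([set x | dotv a x = b] `&` U) !=set0 ->
  ~ hnull n ([set x | dotv a x = b] `&` U).
Proof.
move=> a0 oU [y [/= ayb Uy]] nHU.
have aa : 0 < dotv a a by rewrite lt_def dotv_eq0 a0 dotv_ge0.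
have ea : 0 < enorm a by rewrite enorm_gt0.
pose x := y - a; pose z := y + a.
pose N := [set x | dotv a x = b] `&` U `&` eball y 1.
have bN : bounded_set N.
  apply/bounded_eball; exists (enorm y + 1) => q [_ yq].
  rewrite -(subrK y q) (le_trans (enormD _ _))// addrC lerD2l ltW//.
have Nx q : N q -> enorm a <= enorm (q - x).
  move=> [[/= aqb _] _]; rewrite -(ler_pM2l ea) -expr2 enorm_sqr.
  apply: le_trans (dotv_le _ _); rewrite /x opprB addrCA dotvDr dotvDr dotvNr.
  by rewrite aqb ayb subrr addr0.
have axb : dotv a x != b.
  by rewrite dotvDr dotvNr ayb -subr_eq0 addrC addKr oppr_eq0 gt_eqF.
have bx : b - dotv a x = dotv a a.
  by rewrite /x dotvDr dotvNr ayb opprB addrCA subrr addr0.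
have zx : z - x = 2 *: a.
  by rewrite /z /x opprB addrC addrA subrK scaler_nat mulr2n.
have azx : dotv a (z - x) != 0 by rewrite zx dotvZr mulf_neq0 ?gt_eqF.
have radz : rayproj x a b z = y.
  rewrite /rayproj bx zx dotvZr scalerA mulrC mulrA divff ?mulf_neq0 ?gt_eqF//.
  by rewrite scale1r subrK.
have nW : nbhs z [set w | eball z 1 w /\ (U `&` eball y 1) (rayproj x a b w) /\
    dotv a y < dotv a w].
  apply: filterI; first exact: eball_nbhs.
  apply: filterI.
    apply: rayproj_nbhs => //; rewrite radz; apply: filterI; last exact: eball_nbhs.
    exact: open_nbhs_nbhs.
  by apply: dotv_gt_nbhs; rewrite /z dotvDr ltrDl.
have neg := hnull_shadow (2 * enorm a + 1) (hnull_sub (@subIsetl _ _ _) nHU) bN ea Nx.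
apply: (@not_negligible_open _ _ _ (open_interior _) (ex_intro _ z nW)).
apply: negligibleS neg => w /interior_subset[/= wz [[Urad yrad] yw]]; split.
  have awx : dotv a a < dotv a (w - x).
    by rewrite dotvDr dotvNr -[dotv a a]bx -ayb ltrD2r.
  have awx0 : 0 < dotv a (w - x) by rewrite (lt_trans aa).
  exists ((b - dotv a x) / dotv a (w - x)).
    by rewrite bx divr_ge0 ?(ltW aa) ?(ltW awx0)//= ler_pdivrMr// mul1r ltW.
  by split => //; split => //=; apply: dotv_rayproj; rewrite gt_eqF.
rewrite /= -(subrKA z) (le_trans (enormD _ _))// addrC zx enormZ ger0_norm//.
by rewrite lerD2l ltW.
Qed.

Section StarShaped.
Variables (R : realType) (n : nat).
Local Notation V := 'rV[R]_n.
Variables (K : set V) (c : V) (r : R).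
Hypotheses (r0 : 0 < r) (sK : star_shaped K (eball c r)) (oK : open K).

(** A point of [K] close to [y] can replace [y], the difference being absorbed by
    moving the other end of the segment inside the ball. *)
Lemma star_closure y t : closure K y -> 0 <= t < 1 -> K ((1 - t) *: c + t *: y).
Proof.
move=> cy /andP[t0 t1]; have t1' : 0 < 1 - t by rewrite subr_gt0.
have [y' Ky' yy'] := closure_eball cy (mulr_gt0 r0 t1').
have -> : (1 - t) *: c + t *: y =
    (1 - t) *: (c + (t / (1 - t)) *: (y - y')) + t *: y'.
  rewrite scalerDr scalerA mulrCA divff ?gt_eqF// mulr1 -addrA -scalerDr.
  by rewrite subrK.
apply: sK => //; last by rewrite t0 ltW.
rewrite /eball/= addrC addKr enormZ ger0_norm; last by rewrite divr_ge0// ltW.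
rewrite enormB mulrAC ltr_pdivrMr//; apply: le_lt_trans yy'.
by rewrite ler_piMl ?enorm_ge0// ltW.
Qed.

(** Of two distinct points of a ray issued from [c], the nearer one would be in
    [K] by [star_closure]. *)
Lemma ray_boundary y y' k : closure K y -> closure K y' -> ~ K y -> ~ K y' ->
  0 < k -> y' - c = k *: (y - c) -> y = y'.
Proof.
have H (x x' : V) l : closure K x' -> ~ K x -> 0 < l < 1 -> ~ (x - c = l *: (x' - c)).
  move=> cx' nx /andP[l0 l1] E; apply: nx.
  have -> : x = (1 - l) *: c + l *: x'.
    rewrite -[LHS](subrK c) E scalerBl scale1r scalerBr.
    by rewrite addrC addrA addrAC.
  by apply: star_closure; rewrite // ltW.
move=> cy cy' ny ny' k0 E; have [k1|k1|k1] := ltgtP k 1.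
- by have := H y' y k cy ny'; rewrite k0 k1 => /(_ isT).
- have := H y y' k^-1 cy' ny; rewrite invr_gt0 k0 invf_lt1// k1 => /(_ isT).
  by rewrite E scalerA mulVf ?gt_eqF// scale1r.
- by move: E; rewrite k1 scale1r => /addIr.
Qed.

Section Face.
Variables (a : V) (b : R) (U : set V).
Hypotheses (oU : open U).
Let s := [set x | dotv a x = b] `&` U.
Hypothesis (sK' : s `<=` boundary K).

Lemma face_closure y : s y -> closure K y. Proof. by case/sK'. Qed.
Lemma face_notin y : s y -> ~ K y.
Proof. by case/sK' => _; rewrite ((interior_id K).1 oK). Qed.

(** Otherwise the segment from [c] to [y], contained in [K] up to [y], would also
    be contained in the hyperplane, where the face is a neighbourhood of [y]. *)
Lemma face_center_off y : s y -> dotv a c != b.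
Proof.
move=> sy; apply/eqP => acb.
have Uy : nbhs y U by apply: open_nbhs_nbhs; split => //; case: sy.
have [e e0 eU] := (nbhs_eball _ _).1 Uy.
pose D := enorm (c - y); have D0 : 0 <= D by exact: enorm_ge0.
have eD : 0 < e + D by rewrite ltr_wpDr.
pose l := e / (e + D).
have l0 : 0 < l by rewrite divr_gt0.
have l1 : l <= 1 by rewrite ler_pdivrMr// mul1r lerDl.
pose p := (1 - (1 - l)) *: c + (1 - l) *: y.
have pK : K p by apply: star_closure; [exact: face_closure|lra].
have py : p = y + l *: (c - y).
  by rewrite /p subKr scalerBl scale1r scalerBr addrCA.
apply: (@face_notin p) => //; split.
  case: (sy) => /= ayb _.
  by rewrite /= py dotvDr dotvZr dotvDr dotvNr ayb acb subrr mulr0 addr0.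
apply: eU; rewrite /eball/= py addrC addKr enormZ gtr0_norm//.
by rewrite /l mulrAC ltr_pdivrMr// ltr_pM2l// ltrDr.
Qed.

(** The rays issued from [c] that end near [y] cross the hyperplane at points of
    the face; these belong to the boundary of [K], so the ray leaves [K] there.
    Hence, near [y], [K] is the open side of the hyperplane that contains [c]. *)
Lemma face_local y : s y ->
  nbhs y [set z | K z <-> (dotv a z - b) * (b - dotv a c) < 0].
Proof.
move=> sy; have acb := face_center_off sy.
have [ayb Uy] : dotv a y = b /\ U y by [].
pose be := b - dotv a c; have be0 : be != 0 by rewrite subr_eq0 eq_sym.
have ayc : dotv a (y - c) = be by rewrite dotvDr dotvNr ayb.
have bb : 0 < be * be by rewrite -expr2 lt_def sqr_ge0 sqrf_eq0 be0.
have nW : nbhs y [set z | U (rayproj c a b z) /\ be * dotv a c < dotv (be *: a) z].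
  apply: filterI.
    apply: rayproj_nbhs; first by rewrite ayc.
    by rewrite rayproj_id//; exact: open_nbhs_nbhs.
  by apply: dotv_gt_nbhs; rewrite dotvZl -subr_gt0 -mulrBr ayb.
apply: filterS nW => z [Uz zc].
rewrite dotvZl -subr_gt0 -mulrBr in zc.
have azc : dotv a (z - c) != 0.
  by rewrite dotvDr dotvNr; apply/eqP => E; move: zc; rewrite E mulr0 ltxx.
have srad : s (rayproj c a b z) by split => //=; exact: dotv_rayproj.
pose w := dotv a (z - c) / be.
have w0 : 0 < w.
  have -> : w = be * (dotv a z - dotv a c) / (be * be).
    by rewrite /w dotvDr dotvNr; field.
  exact: divr_gt0.
have zE := rayprojP acb azc; rewrite -/be -/w in zE.
change (K z <-> (dotv a z - b) * be < 0).
have -> : (dotv a z - b) * be = be * be * (w - 1).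
  have -> : dotv a z - b = dotv a z - dotv a c - be by rewrite /be; ring.
  by rewrite /w dotvDr dotvNr; field.
rewrite pmulr_rlt0// subr_lt0; split => [Kz|w1].
  rewrite ltNge; apply/negP => w1; apply: (face_notin srad).
  have -> : rayproj c a b z = (1 - w^-1) *: c + w^-1 *: z.
    rewrite {2}zE scalerDr scalerA mulVf ?gt_eqF// scale1r scalerBl scale1r.
    by rewrite addrA subrK addrC subrK.
  apply: sK => //; first by rewrite /eball/= subrr enorm0.
  by rewrite invr_ge0 ltW//= invf_le1.
rewrite zE (_ : _ + _ = (1 - w) *: c + w *: rayproj c a b z).
  by apply: star_closure; [exact: face_closure|rewrite w1 ltW].
by rewrite scalerBr scalerBl scale1r addrA addrAC.
Qed.

End Face.
End StarShaped.

(** * Normals and pyramids of a face *)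

Section FacePairs.
Variables (R : realType) (n : nat).
Local Notation V := 'rV[R]_n.

(** Both sets coincide near [y] with the same open half-space. *)
Lemma same_side_meet (K1 K2 : set V) (c1 c2 : V) (r1 r2 : R)
    (a : V) (b : R) (U : set V) y :
  0 < r1 -> 0 < r2 -> star_shaped K1 (eball c1 r1) -> star_shaped K2 (eball c2 r2) ->
  open K1 -> open K2 -> open U -> a != 0 ->
  [set x | dotv a x = b] `&` U `<=` boundary K1 ->
  [set x | dotv a x = b] `&` U `<=` boundary K2 ->
  dotv a y = b -> U y -> 0 < (b - dotv a c1) * (b - dotv a c2) ->
  (K1 `&` K2) !=set0.
Proof.
move=> r10 r20 s1 s2 o1 o2 oU a0 f1 f2 ayb Uy bb.
have aa : 0 < dotv a a by rewrite lt_def dotv_eq0 a0 dotv_ge0.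
have b10 : b - dotv a c1 != 0.
  by apply/eqP => E; move: bb; rewrite E mul0r ltxx.
have W1 := face_local r10 s1 o1 oU f1 (conj ayb Uy).
have W2 := face_local r20 s2 o2 oU f2 (conj ayb Uy).
have [t t0 [/= z1 z2]] := open_segment (- (b - dotv a c1) *: a) (filterI W1 W2).
set z := _ + _ in z1 z2.
have az be : (dotv a z - b) * be = - (t * dotv a a * ((b - dotv a c1) * be)).
  by rewrite dotvDr !dotvZr ayb; ring.
have ta : 0 < t * dotv a a by exact: mulr_gt0.
exists z; split.
  apply/z1; rewrite az oppr_lt0 (mulr_gt0 ta)//.
  by rewrite -expr2 lt_def sqr_ge0 sqrf_eq0 b10.
by apply/z2; rewrite az oppr_lt0 (mulr_gt0 ta).
Qed.

Lemma outward_normal_exists (K : set V) (c : V) (r : R)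
    (a : V) (b : R) (U : set V) :
  0 < r -> star_shaped K (eball c r) -> open K -> open U -> a != 0 ->
  [set x | dotv a x = b] `&` U `<=` boundary K ->
  ([set x | dotv a x = b] `&` U) !=set0 ->
  exists v, outward_normal K ([set x | dotv a x = b] `&` U) v.
Proof.
move=> r0 sK oK oU a0 sub [y0 sy0].
have acb := face_center_off r0 sK oK oU sub sy0.
have aa : 0 < dotv a a by rewrite lt_def dotv_eq0 a0 dotv_ge0.
have ea : 0 < enorm a by rewrite enorm_gt0.
pose be := b - dotv a c; have be0 : be != 0 by rewrite subr_eq0 eq_sym.
have bb : 0 < be * be by rewrite -expr2 lt_def sqr_ge0 sqrf_eq0 be0.
pose l := (Num.sg be / enorm a); pose v := l *: a.
have v1 : enorm v = 1.
  by rewrite enormZ normrM normr_sg be0 mul1r normfV (gtr0_norm ea) mulVf ?gt_eqF.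
have lbe : 0 < l * be.
  by rewrite /l mulrAC divr_gt0// -normrEsg normr_gt0.
exists v; split => //.
  move=> x y [/= ax _] [/= ay _].
  by rewrite dotvZl dotvDr dotvNr ax ay subrr mulr0.
move=> x sx; have W := face_local r0 sK oK oU sub sx.
have axb : dotv a x = b by case: sx.
have [e e0 eW] := (nbhs_eball _ _).1 W.
near=> t.
have t0 : 0 < t by near: t; exact: nbhs_right_gt.
have te : t < e by near: t; exact: nbhs_right_lt.
have tv : enorm (t *: v) < e by rewrite enormZ v1 mulr1 gtr0_norm.
have Wm : eball x e (x - t *: v) by rewrite /eball/= addrC addKr enormN.
have Wp : eball x e (x + t *: v) by rewrite /eball/= addrC addKr.
split.
  apply/(eW _ Wm).
  have -> : (dotv a (x - t *: v) - b) * (b - dotv a c) = - (t * dotv a a * (l * be)).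
    by rewrite dotvDr dotvNr !dotvZr axb /be; ring.
  by rewrite oppr_lt0 (mulr_gt0 (mulr_gt0 t0 aa)).
move=> /(eW _ Wp).
have -> : (dotv a (x + t *: v) - b) * (b - dotv a c) = t * dotv a a * (l * be).
  by rewrite dotvDr !dotvZr axb /be; ring.
by apply/negP; rewrite -leNgt ltW// (mulr_gt0 (mulr_gt0 t0 aa)).
Unshelve. all: by end_near. Qed.

(** The pyramids of a mesh, with an arbitrary apex. *)
Definition pyr (c : V) (s : set V) : set V :=
  [set x | exists y, exists2 t : R, s y /\ 0 < t < 1 &
    x = (1 - t) *: c + t *: y].

Section Pyramids.
Variables (K : set V) (c : V) (r : R).
Hypotheses (r0 : 0 < r) (sK : star_shaped K (eball c r)) (oK : open K).

Lemma pyr_sub (s : set V) : s `<=` boundary K -> pyr c s `<=` K.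
Proof.
move=> sb x [y [t [sy /andP[t0 t1]] ->]]; apply: star_closure r0 sK _ _ _ _.
  by case: (sb _ sy).
by rewrite t1 ltW.
Qed.

Variables (a : V) (b : R) (U : set V).
Hypothesis (oU : open U).
Let s := [set x | dotv a x = b] `&` U.
Hypothesis (sub : s `<=` boundary K).

(** The pyramid is cut out by continuous conditions: the projection on the
    hyperplane is in [U], and the height is strictly between those of the apex
    and of the base. *)
Lemma open_pyr : open (pyr c s).
Proof.
rewrite openE => x [y [t [sy /andP[t0 t1]] xE]].
have acb := face_center_off r0 sK oK oU sub sy.
have [ayb Uy] : dotv a y = b /\ U y by [].
pose be := b - dotv a c; have be0 : be != 0 by rewrite subr_eq0 eq_sym.
have bb : 0 < be * be by rewrite -expr2 lt_def sqr_ge0 sqrf_eq0 be0.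
have xc : x - c = t *: (y - c).
  by rewrite xE scalerBl scale1r scalerBr addrC addrA addKr addrC.
have axc : dotv a (x - c) = t * be by rewrite xc dotvZr dotvDr dotvNr ayb.
have axc0 : dotv a (x - c) != 0 by rewrite axc mulf_neq0// gt_eqF.
have radx : rayproj c a b x = y.
  rewrite /rayproj axc xc scalerA -/be.
  have -> : be / (t * be) * t = 1 by field; rewrite be0 gt_eqF.
  by rewrite scale1r addrC subrK.
have aex : dotv (be *: a) x - be * dotv a c = t * (be * be).
  rewrite dotvZl -mulrBr mulrCA -axc dotvDr dotvNr//.
have W : nbhs x [set z | U (rayproj c a b z) /\
    (be * dotv a c < dotv (be *: a) z /\ dotv (be *: a) z < be * b)].
  apply: filterI.
    by apply: rayproj_nbhs => //; rewrite radx; exact: open_nbhs_nbhs.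
  apply: filterI.
    by apply: dotv_gt_nbhs; rewrite -subr_gt0 aex mulr_gt0.
  apply: dotv_lt_nbhs; rewrite -(ltrD2r (- (be * dotv a c))) aex -mulrBr -/be.
  by rewrite gtr_pMl.
apply: filterS W => z [Uz [z1 z2]].
rewrite dotvZl -subr_gt0 -mulrBr in z1.
rewrite dotvZl -(ltrD2r (- (be * dotv a c))) -!mulrBr -/be in z2.
have azc : dotv a (z - c) != 0.
  by rewrite dotvDr dotvNr; apply/eqP => E; move: z1; rewrite E mulr0 ltxx.
exists (rayproj c a b z); exists (dotv a (z - c) / be).
  split; first by split => //=; exact: dotv_rayproj.
  have -> : dotv a (z - c) / be = be * (dotv a z - dotv a c) / (be * be).
    by rewrite dotvDr dotvNr; field.
  by rewrite divr_gt0//= ltr_pdivrMr// mul1r.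
rewrite {1}(rayprojP acb azc) -/be; move: (_ / be) (rayproj _ _ _ _) => w q.
by rewrite scalerBr scalerBl scale1r addrA addrAC.
Qed.

Variables (a' : V) (b' : R) (U' : set V).
Hypothesis (oU' : open U').
Let s' := [set x | dotv a' x = b'] `&` U'.
Hypothesis (sub' : s' `<=` boundary K).

(** Every ray issued from the centre meets the boundary once, so two faces with
    intersecting pyramids coincide near some point. *)
Lemma pyr_meet : (pyr c s `&` pyr c s') !=set0 ->
  exists W, [/\ open W, (s `&` W) !=set0 & s `&` W `<=` s'].
Proof.
move=> [z [[y [t [sy /andP[t0 t1]] zE]] [y' [t' [sy' /andP[t0' t1']] zE']]]].
have Kc x : boundary K x -> closure K x by case.
have Kn x : boundary K x -> ~ K x.
  by case=> _; rewrite ((interior_id K).1 oK).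
have cone x l : (1 - l) *: c + l *: x - c = l *: (x - c).
  by rewrite scalerBl scale1r scalerBr addrC addrA addKr addrC.
have E : t' *: (y' - c) = t *: (y - c) by rewrite -!cone -zE -zE'.
have yy' : y = y'.
  apply: (ray_boundary r0 sK (k := t / t')); rewrite ?divr_gt0//.
  - exact/Kc/sub.
  - exact/Kc/sub'.
  - exact/Kn/sub.
  - exact/Kn/sub'.
  by rewrite mulrC -scalerA -E scalerA mulVf ?gt_eqF// scale1r.
have acb := face_center_off r0 sK oK oU' sub' sy'.
have [ayb Uy] : dotv a' y' = b' /\ U' y' by [].
pose be := b' - dotv a' c; have be0 : be != 0 by rewrite subr_eq0 eq_sym.
have bb : 0 < be * be by rewrite -expr2 lt_def sqr_ge0 sqrf_eq0 be0.
have W : nbhs y' [set w | U' (rayproj c a' b' w) /\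
    be * dotv a' c < dotv (be *: a') w].
  apply: filterI.
    apply: rayproj_nbhs; first by rewrite dotvDr dotvNr ayb.
    by rewrite rayproj_id//; exact: open_nbhs_nbhs.
  by apply: dotv_gt_nbhs; rewrite dotvZl -subr_gt0 -mulrBr ayb.
exists (interior [set w | U' (rayproj c a' b' w) /\
    be * dotv a' c < dotv (be *: a') w]); split.
- exact: open_interior.
- by exists y; split => //; rewrite yy'; exact: W.
move=> w [sw /interior_subset[Uw]]; rewrite dotvZl -subr_gt0 -mulrBr => w0.
have awc : dotv a' (w - c) != 0.
  by rewrite dotvDr dotvNr; apply/eqP => Z; move: w0; rewrite Z mulr0 ltxx.
have sr : s' (rayproj c a' b' w) by split => //=; exact: dotv_rayproj.
suff -> : w = rayproj c a' b' w by [].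
apply: (ray_boundary r0 sK (k := be / dotv a' (w - c))).
- exact/Kc/sub.
- exact/Kc/sub'.
- exact/Kn/sub.
- exact/Kn/sub'.
- have -> : be / dotv a' (w - c) = be * be / (be * (dotv a' w - dotv a' c)).
    by rewrite dotvDr dotvNr; field; rewrite be0 -dotvNr -dotvDr awc.
  by rewrite divr_gt0.
by rewrite /rayproj addrC addKr.
Qed.

End Pyramids.
End FacePairs.

(** * Geometry of a mesh *)

Section MeshGeometry.
Variables (R : realType) (n : nat).
Local Notation V := 'rV[R]_n.+1.
Variables (Omega : set V) (M : mesh Omega) (mu : R).
Hypotheses (n0 : (0 < n)%N) (bO : bounded_set Omega) (mu0 : 0 < mu).
Hypothesis (star : forall K, cells M K ->
  star_shaped K (eball (center M K) (mu * mesh_size M))).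
Local Notation h := (mesh_size M).

Lemma open_cell K : cells M K -> open K.
Proof. by move=> /mesh_cell[]. Qed.

Lemma subset_cell K : cells M K -> K `<=` Omega.
Proof. by move=> /mesh_cell[]. Qed.

Lemma bounded_cell K : cells M K -> bounded_set K.
Proof.
move=> cK; apply/bounded_eball; have [B HB] := (bounded_eball Omega).1 bO.
by exists B => x /(subset_cell cK)/HB.
Qed.

Lemma diam_cell_le K : cells M K -> diam K <= h.
Proof.
move=> cK; apply: ub_le_sup; last by exists K.
exists (diam Omega) => _ [L cL <-]; apply: diam_le; first exact: diam_ge0.
by move=> x y /(subset_cell cL) Ox /(subset_cell cL) Oy; exact: enorm_le_diam.
Qed.

Lemma cell_dist_le K x y : cells M K -> closure K x -> closure K y ->
  enorm (x - y) <= h.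
Proof.
move=> cK; apply: closure_dist_le => {x y} x y Kx Ky.
exact: le_trans (enorm_le_diam (bounded_cell cK) Kx Ky) (diam_cell_le cK).
Qed.

Lemma mesh_size_gt0 K : cells M K -> 0 < h.
Proof.
move=> cK; have Kc := mesh_center cK.
have W : nbhs (center M K) K.
  by apply: open_nbhs_nbhs; split => //; exact: open_cell.
pose v : V := const_mx 1.
have v0 : v != 0.
  by apply/eqP => /rowP/(_ ord0); rewrite !mxE => /eqP; rewrite oner_eq0.
have [t t0 Kt] := open_segment v W.
have := cell_dist_le cK (subset_closure Kt) (subset_closure Kc).
by apply: lt_le_trans; rewrite addrC addKr enormZ mulr_gt0// ?enorm_gt0 ?normr_gt0 ?gt_eqF.
Qed.

Lemma cell_radius_gt0 K : cells M K -> 0 < mu * h.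
Proof. by move=> cK; rewrite mulr_gt0// (mesh_size_gt0 cK). Qed.

Lemma face_boundary K s : cells M K -> faces_of M K s -> closure s `<=` boundary K.
Proof. by move=> cK fs; rewrite (mesh_boundary cK) => x cx; exists s. Qed.

Lemma face_sub_boundary K s : cells M K -> faces_of M K s -> s `<=` boundary K.
Proof.
by move=> cK fs; apply: subset_trans (face_boundary cK fs); exact: subset_closure.
Qed.

Lemma face_in_faces K s : cells M K -> faces_of M K s -> faces M s.
Proof. by move=> cK fs; rewrite mesh_faces; exists K. Qed.

Lemma faceP s : faces M s -> exists a b U,
  [/\ a != 0, open U & s = [set x | dotv a x = b] `&` U].
Proof.
by move=> /mesh_face[_ [H [U [[a [b [a0 ->]]] oU ->]]] _ _]; exists a, b, U.
Qed.

Lemma boundary_notin K x : cells M K -> boundary K x -> ~ K x.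
Proof.
by move=> cK [_]; rewrite ((interior_id K).1 (open_cell cK)).
Qed.

Lemma hausdorff_eq0_sub (A B : set V) : A `<=` B ->
  hausdorff n B = 0%E -> hnull n A.
Proof. by move=> AB /(hausdorff_eq0_hnull n0); exact: hnull_sub. Qed.

(** A set that contains an open piece of a face has positive measure in
    codimension one; this is how the conditions of a mesh on null intersections
    are exploited. *)
Lemma face_open_not_sub s U (B : set V) : faces M s -> open U ->
  (s `&` U) !=set0 -> s `&` U `<=` B -> hausdorff n B <> 0%E.
Proof.
move=> /faceP[a [b [W [a0 oW ->]]]] oU ne sB /(hausdorff_eq0_sub sB).
by rewrite -setIA in ne *; apply: hyperplane_open_not_hnull => //; exact: openI.
Qed.

(** If two cells meet, their closures do not meet along common faces only, so
    the intersections of each closure with the other boundary are null. Then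
    neither cell meets the boundary of the other, where it would contain an open
    piece of a face, and connectedness makes each cell contain the other. *)
Lemma cells_disjoint K L : cells M K -> cells M L -> (K `&` L) !=set0 -> K = L.
Proof.
move=> cK cL [z [Kz Lz]]; apply: contrapT => KL.
have [[H1 H2]|[_ E]] := mesh_interface cK cL KL; last first.
  have : (closure K `&` closure L) z by split; exact: subset_closure.
  rewrite E => -[s [fK fL] sz]; apply: (boundary_notin cK _ Kz).
  exact: face_boundary fK _ sz.
have sub A B : cells M A -> cells M B -> A z -> B z ->
    hausdorff n (closure A `&` boundary B) = 0%E -> A `<=` B.
  move=> cA cB Az Bz H0.
  have AB0 : A `&` boundary B = set0.
    apply: contrapT => /eqP/set0P[w [Aw Bw]].
    have := Bw; rewrite (mesh_boundary cB) => -[s fs sw].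
    have [v [sv Av]] := sw _ (open_nbhs_nbhs (conj (open_cell cA) Aw)).
    apply: (face_open_not_sub (face_in_faces cB fs) (open_cell cA) _ _ H0).
      by exists v.
    move=> q [sq Aq]; split; first exact: subset_closure.
    exact: face_sub_boundary fs _ sq.
  have conA : connected A by have [] := mesh_cell cA.
  have AB : A `&` B = A `&` closure B.
    apply/seteqP; split => q [Aq Bq]; split => //; first exact: subset_closure.
    apply: contrapT => nB; have : (A `&` boundary B) q.
      by split => //; split => //; rewrite ((interior_id B).1 (open_cell cB)).
    by rewrite AB0.
  have : A `&` B = A.
    apply: conA; first by exists z.
    - by exists B => //; exact: open_cell.
    - by exists (closure B) => //; exact: closed_closure.
  by move=> <- q [].
apply: KL; apply/seteqP; split.
  exact: sub cK cL Kz Lz H1.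
by apply: sub cL cK Lz Kz _; rewrite setIC.
Qed.

(** Two of the three centres are on the same side of the hyperplane of the face,
    so the two cells meet near the face, and are equal. *)
Lemma face_three_cells s K1 K2 K3 : cells M K1 -> cells M K2 -> cells M K3 ->
  faces_of M K1 s -> faces_of M K2 s -> faces_of M K3 s ->
  [\/ K1 = K2, K1 = K3 | K2 = K3].
Proof.
move=> c1 c2 c3 f1 f2 f3.
have [a [b [U [a0 oU sE]]]] := faceP (face_in_faces c1 f1).
have [y sy] : s !=set0 by have [] := mesh_face (face_in_faces c1 f1).
have sub K : cells M K -> faces_of M K s ->
    [set x | dotv a x = b] `&` U `<=` boundary K.
  by move=> cK fK; rewrite -sE; exact: face_sub_boundary.
have := sy; rewrite sE => -[/= ayb Uy].
have off K : cells M K -> faces_of M K s -> b - dotv a (center M K) != 0.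
  move=> cK fK; rewrite subr_eq0 eq_sym.
  apply: (face_center_off (cell_radius_gt0 cK) (star cK) (open_cell cK) oU (sub _ cK fK)).
  by rewrite -sE; exact: sy.
have same K L : cells M K -> cells M L -> faces_of M K s -> faces_of M L s ->
    0 < (b - dotv a (center M K)) * (b - dotv a (center M L)) -> K = L.
  move=> cK cL fK fL H; apply: cells_disjoint => //.
  exact: (same_side_meet (cell_radius_gt0 cK) (cell_radius_gt0 cL) (star cK)
    (star cL) (open_cell cK) (open_cell cL) oU a0 (sub _ cK fK) (sub _ cL fL)
    ayb Uy H).
have := off _ c1 f1; have := off _ c2 f2; have := off _ c3 f3.
have := same _ _ c1 c2 f1 f2; have := same _ _ c1 c3 f1 f3.
have := same _ _ c2 c3 f2 f3.
move: (b - _) (b - _) (b - _) => x1 x2 x3 h23 h13 h12.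
rewrite !neq_lt => /orP[p3|p3] /orP[p2|p2] /orP[p1|p1].
- by apply: Or31; apply: h12; rewrite nmulr_lgt0.
- by apply: Or33; apply: h23; rewrite nmulr_lgt0.
- by apply: Or32; apply: h13; rewrite nmulr_lgt0.
- by apply: Or31; apply: h12; rewrite mulr_gt0.
- by apply: Or31; apply: h12; rewrite nmulr_lgt0.
- by apply: Or32; apply: h13; rewrite mulr_gt0.
- by apply: Or33; apply: h23; rewrite mulr_gt0.
- by apply: Or31; apply: h12; rewrite mulr_gt0.
Qed.

Lemma separates_unique s K L K' L' : separates M s (K, L) -> separates M s (K', L') ->
  (K = K' /\ L = L') \/ (K = L' /\ L = K').
Proof.
move=> [/= cK cL KL fK fL] [/= cK' cL' KL' fK' fL'].
have [//|E|E] := face_three_cells cK cL cK' fK fL fK';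
have [//|E'|E'] := face_three_cells cK cL cL' fK fL fL'.
- by case: KL'; rewrite -E -E'.
- by left.
- by right.
- by case: KL'; rewrite -E -E'.
Qed.

Lemma adjacentP s : interior_faces M s -> separates M s (adjacent M s).
Proof. by move=> [_ [KL sKL]]; exact: (xgetPex (set0, set0) (ex_intro _ KL sKL)). Qed.

Lemma jump_adjacent (u : set V -> R) s K L : separates M s (K, L) ->
  `|u K - u L| = `|u (adjacent M s).2 - u (adjacent M s).1|.
Proof.
move=> sKL; have /adjacentP : interior_faces M s.
  by split; [case: sKL => /= cK _ _ fK _; exact: face_in_faces fK|exists (K, L)].
case: (adjacent M s) => K' L' /(separates_unique sKL)[[-> ->]|[-> ->]] //=.
by rewrite distrC.
Qed.

Lemma enorm_normal s : interior_faces M s ->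
  enorm (normal (adjacent M s).1 s) = 1.
Proof.
move=> /adjacentP; case: (adjacent M s) => K L [/= cK _ _ fK _].
have [a [b [U [a0 oU sE]]]] := faceP (face_in_faces cK fK).
have sne : s !=set0 by have [] := mesh_face (face_in_faces cK fK).
have sub := face_sub_boundary cK fK.
rewrite sE in sub sne; have := outward_normal_exists (cell_radius_gt0 cK) (star cK)
  (open_cell cK) oU a0 sub sne.
by rewrite -sE => /(xgetPex 0)[].
Qed.

Lemma pyramidE K s : pyramid M K s = pyr (center M K) s.
Proof. by []. Qed.

Lemma pyramid_sub K s : cells M K -> faces_of M K s -> pyramid M K s `<=` K.
Proof.
move=> cK fK; apply: (pyr_sub (cell_radius_gt0 cK) (star cK)).
exact: face_sub_boundary fK.
Qed.

Lemma pyramid_open K s : cells M K -> faces_of M K s -> open (pyramid M K s).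
Proof.
move=> cK fK; have [a [b [U [a0 oU sE]]]] := faceP (face_in_faces cK fK).
have sub := face_sub_boundary cK fK.
rewrite pyramidE sE; rewrite sE in sub.
exact: open_pyr (cell_radius_gt0 cK) (star cK) (open_cell cK) _ _ _ oU sub.
Qed.

Lemma pyramid_neq0 K s : cells M K -> faces_of M K s -> pyramid M K s !=set0.
Proof.
move=> cK fK; have [[y sy] _ _ _] := mesh_face (face_in_faces cK fK).
by exists ((1 - 2^-1) *: center M K + 2^-1 *: y), y, 2^-1 => //; split => //; lra.
Qed.

Lemma pyramid_disjoint K s s' : cells M K -> faces_of M K s -> faces_of M K s' ->
  (pyramid M K s `&` pyramid M K s') !=set0 -> s = s'.
Proof.
move=> cK fs fs'; have Fs := face_in_faces cK fs.
have [a [b [U [a0 oU sE]]]] := faceP Fs.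
have [a' [b' [U' [a0' oU' sE']]]] := faceP (face_in_faces cK fs').
have sub := face_sub_boundary cK fs; have sub' := face_sub_boundary cK fs'.
rewrite sE in sub; rewrite sE' in sub'.
rewrite !pyramidE {1}sE {1}sE' => meet.
have [W [oW ne sW]] := pyr_meet (cell_radius_gt0 cK) (star cK) (open_cell cK)
   sub oU' sub' meet.
rewrite -sE -sE' in ne sW; apply: contrapT => ss'.
apply: (face_open_not_sub Fs oW ne _ (mesh_faces_disj cK fs fs' ss')).
by move=> q sq; split; [case: sq|exact: sW].
Qed.

Lemma diamond_open s : open (diamond M s).
Proof. exact: open_interior. Qed.

Lemma diamond_sub s : interior_faces M s ->
  diamond M s `<=` closure (adjacent M s).1 `|` closure (adjacent M s).2.
Proof.
move=> /adjacentP[c1 c2 _ f1 f2]; apply: subset_trans (@interior_subset _ _) _.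
rewrite closureU; apply: setUSS; apply: closure_subset; exact: pyramid_sub.
Qed.

Lemma diamond_neq0 s : interior_faces M s -> diamond M s !=set0.
Proof.
move=> /adjacentP[c1 _ _ f1 _]; have [x px] := pyramid_neq0 c1 f1; exists x.
have : pyramid M (adjacent M s).1 s `<=` diamond M s; last exact.
rewrite /diamond -(open_subsetE _ (pyramid_open c1 f1)).
by apply: subset_trans (@subset_closure _ _) => y; left.
Qed.

(** The pyramids of [s] are open and dense in its diamond, and similarly for
    [s']; so two pyramids meet, they are in the same cell, and [pyr_meet] provides
    an open piece of [s] inside [s']. *)
Lemma diamond_disjoint s s' : interior_faces M s -> interior_faces M s' ->
  (diamond M s `&` diamond M s') !=set0 -> s = s'.
Proof.
move=> ints ints' [x [Dx Dx']].
(* an open set that meets a diamond meets one of its two pyramids *)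
have meets t W : open W -> (W `&` diamond M t) !=set0 ->
    (W `&` (pyramid M (adjacent M t).1 t `|` pyramid M (adjacent M t).2 t)) !=set0.
  move=> oW [w [Ww /interior_subset Dw]].
  by have [v [Pv Wv]] := Dw _ (open_nbhs_nbhs (conj oW Ww)); exists v.
have [y [Dy Py]] := meets s _ (@diamond_open s') (ex_intro _ x (conj Dx' Dx)).
have [K [cK fK PKy]] : exists K, [/\ cells M K, faces_of M K s & pyramid M K s y].
  by have [c1 c2 _ f1 f2] := adjacentP ints; case: Py => Py;
    [exists (adjacent M s).1|exists (adjacent M s).2].
have [z [PKz Pz]] := meets s' _ (pyramid_open cK fK) (ex_intro _ y (conj PKy Dy)).
have [K' [cK' fK' PKz']] : exists K, [/\ cells M K, faces_of M K s' & pyramid M K s' z].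
  by have [c1 c2 _ f1 f2] := adjacentP ints'; case: Pz => Pz;
    [exists (adjacent M s').1|exists (adjacent M s').2].
have KK' : K = K'.
  apply: cells_disjoint => //; exists z; split.
    exact: pyramid_sub fK _ PKz.
  exact: pyramid_sub fK' _ PKz'.
rewrite -KK' in fK' PKz'.
by apply: (pyramid_disjoint cK) => //; exists z.
Qed.

End MeshGeometry.

(** * Jumps along a segment *)

Lemma ler_sum_uniq_sub (R : numDomainType) (T : eqType) (F G : seq T) (g : T -> R) :
  uniq F -> uniq G -> {subset F <= G} -> (forall x, x \in G -> 0 <= g x) ->
  \sum_(x <- F) g x <= \sum_(x <- G) g x.
Proof.
move=> uF uG FG g0.
rewrite (bigID (mem F) _ g (r := G)) /=.
have -> : \sum_(x <- F) g x = \sum_(x <- G | x \in F) g x.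
  rewrite -[RHS]big_filter; apply: perm_big; apply: uniq_perm => //.
    exact: filter_uniq.
  by move=> x; rewrite mem_filter; case: (boolP (x \in F)) => //= /FG ->.
by rewrite lerDl big_seq_cond sumr_ge0// => x /andP[xG _]; exact: g0.
Qed.

Section Path.
Variables (R : realType) (n : nat).
Local Notation V := 'rV[R]_n.+1.
Variables (Omega : set V) (M : mesh Omega) (mu : R).
Hypotheses (n0 : (0 < n)%N) (bO : bounded_set Omega) (mu0 : 0 < mu).
Hypothesis (star : forall K, cells M K ->
  star_shaped K (eball (center M K) (mu * mesh_size M))).
Variables (u : set V -> R) (x y : V).

Let crossed (s : set V) := shadow x (closure s) y.

Let linked (K L : set V) := exists2 s, separates M s (K, L) & crossed s.

Let jump (s : set V) := `|u (adjacent M s).2 - u (adjacent M s).1|.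

(** Consecutive cells of the path are separated by a crossed face. A face
   determines the pair of cells that it separates, so on a path without repeated
   cells these faces are pairwise distinct. *)
Lemma path_jump (T : finType) (f : T -> set V) (e : rel T) (K : T) (p : seq T) :
  injective f -> (forall K L, e K L -> linked (f K) (f L)) ->
  path e K p -> uniq (K :: p) ->
  exists F : seq (set V), [/\ uniq F,
    forall s, s \in F -> interior_faces M s /\ crossed s,
    forall s, s \in F -> exists2 KL, separates M s (f KL.1, f KL.2) &
      (KL.1 \in K :: p) && (KL.2 \in K :: p) &
    `|u (f K) - u (f (last K p))| <= \sum_(s <- F) jump s].
Proof.
move=> finj eP; elim: p K => [|L p IH] K /=.
  by exists [::]; split => //; rewrite subrr normr0 big_nil.
move=> /andP[KL pL] /andP[Kp uLp].
have [F [uF F1 F2 Fle]] := IH _ pL uLp.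
have [s sKL sc] := eP _ _ KL.
exists (s :: F); split.
- rewrite /= uF andbT; apply/negP => /F2[[K1 K2] /= sK12 /andP[K1p K2p]].
  by have [[/finj E _]|[/finj E _]] := separates_unique n0 bO mu0 star sKL sK12;
    move: Kp; rewrite E ?K1p ?K2p.
- move=> t; rewrite inE => /orP[/eqP->|/F1//]; split => //; split; last first.
    by exists (f K, f L).
  by case: sKL => /= cK _ _ fK _; exact: face_in_faces fK.
- move=> t; rewrite inE => /orP[/eqP->|/F2[KL' ? /andP[k1 k2]]].
    by exists (K, L) => //=; rewrite !inE !eqxx orbT.
  by exists KL' => //; rewrite (in_cons K (L :: p)) k1 orbT (in_cons K (L :: p)) k2 orbT.
- rewrite big_cons; apply: le_trans (ler_distD (u (f L)) _ _) _; rewrite lerD//.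
  by rewrite /jump (jump_adjacent n0 bO mu0 star u sKL).
Qed.

(** Link two cells when they share a face crossed by the segment. If the class of
    [K0] did not contain [K1], the closures of the cells of the class and those of
    the other cells would be two closed sets covering the segment. By
    connectedness they would have a common point, at which two cells that are
    not linked touch. The assumption on [y] excludes contacts along null sets,
    and any other contact is on a common face, which links the two cells. *)
Lemma segment_jump (IF : seq (set V)) (K0 K1 : set V) :
  uniq IF -> interior_faces M = [set` IF] ->
  cells M K0 -> cells M K1 -> K0 x -> K1 y ->
  (forall t : R, 0 <= t <= 1 -> closure Omega (x + t *: (y - x))) ->
  (forall K L, cells M K -> cells M L ->
    hausdorff n (closure K `&` boundary L) = 0%E ->
    ~ shadow x (closure K `&` boundary L) y) ->
  `|u K0 - u K1| <= \sum_(s <- IF) `|u (adjacent M s).2 - u (adjacent M s).1| *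
    \1_(shadow x (closure s)) y.
Proof.
move=> uIF IFE cK0 cK1 K0x K1y segO gen.
have [cs csE] := (finite_seqP _).1 (cells_finite M).
have inC K : cells M K -> K \in cs by rewrite csE.
have Cin (K : seq_sub cs) : cells M (val K) by rewrite csE; exact: valP.
pose T : finType := seq_sub cs.
pose e : rel T := fun K L => `[< linked (val K) (val L) >].
pose T0 : T := SeqSub (inC _ cK0); pose T1 : T := SeqSub (inC _ cK1).
pose g (t : R) : V := x + t *: (y - x).
have gc : continuous g.
  move=> t; apply: cvgD; first exact: cvg_cst.
  by apply: cvgZr_tmp; exact: cvg_id.
have con : connect e T0 T1.
  (* the times at which the segment is in the closure of a cell of [P] *)
  pose C (P : T -> Prop) := \bigcup_(K in [set K : T | P K]) (g @^-1` closure (val K)).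
  have cC P : closed (C P).
    apply: closed_bigcup; first exact: finite_finset.
    move=> K _; apply: closed_comp => [t _|]; [exact: gc|exact: closed_closure].
  pose P (K : T) : Prop := connect e T0 K.
  have cover t : 0 <= t <= 1 -> C P t \/ C (fun K => ~ P K) t.
    move=> t01; have := segO _ t01; rewrite (mesh_cover M) => -[K cK Kt].
    have [PK|PK] := pselect (P (SeqSub (inC _ cK))); [left|right];
      by exists (SeqSub (inC _ cK)).
  have disj t : 0 <= t <= 1 -> C P t -> ~ C (fun K => ~ P K) t.
    move=> t01 [K PK Kt] [L PL Lt]; have nPL := PL; apply: nPL.
    apply: (connect_trans PK); apply: connect1; apply/asboolP.
    have KL : val K <> val L.
      by move=> /val_inj E; move: PL; rewrite -E.
    have cLK : closure (val K) `&` closure (val L) `<=`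
        closure (val K) `&` boundary (val L).
      move=> z [Kz Lz]; split => //; split => //.
      rewrite ((interior_id (val L)).1 (open_cell (Cin L))) => zL.
      have [w [Kw Lw]] := Kz _ (open_nbhs_nbhs (conj (open_cell (Cin L)) zL)).
      by apply: KL; apply: (cells_disjoint n0 (Cin K) (Cin L)); exists w.
    have [[H1 _]|[_ E]] := mesh_interface (Cin K) (Cin L) KL.
      exfalso; apply: (gen _ _ (Cin K) (Cin L) H1); exists t => //.
      by apply: cLK; split.
    have : (closure (val K) `&` closure (val L)) (g t) by [].
    rewrite E => -[s [fK fL] st]; exists s; last by exists t.
    by split => //; exact: Cin.
  have AE : `[0, 1]%classic `&` C P = `[0, 1]%classic.
    apply: (@segment_connected R 0 1).
    - exists 0; split; first by rewrite /= in_itv/= lexx ler01.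
      exists T0; first exact: connect0.
      by rewrite /preimage/= /g scale0r addr0; exact: subset_closure.
    - exists (~` C (fun K => ~ P K)); first exact: closed_openC.
      apply/seteqP; split => t [t01 Ct]; split => //; have t01' := t01;
        rewrite /= in_itv/= in t01'.
        exact: disj.
      by have [] := cover t t01'.
    - by exists (C P).
  have : (`[0, 1]%classic `&` C P) 1 by rewrite AE /= in_itv/= lexx ler01.
  move=> [_ [K PK]]; rewrite /preimage/= /g scale1r addrC subrK => Ky.
  suff KT1 : K = T1 by rewrite -KT1.
  have [w [Kw K1w]] := Ky _ (open_nbhs_nbhs (conj (open_cell cK1) K1y)).
  by apply/val_inj/(cells_disjoint n0 (Cin K) cK1); exists w.
have [p0 pp0 lp0] := connectP con.
move: lp0; case: (shortenP pp0) => p pp up _ lp.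
have eP (K L : T) : e K L -> linked (val K) (val L) by move=> /asboolP.
have [F [uF F1 _]] := path_jump (@val_inj _ _ _) eP pp up.
rewrite -lp /= => Fle; apply: (le_trans Fle).
pose w s : R := jump s * \1_(shadow x (closure s)) y.
rewrite (eq_big_seq w); last first.
  by move=> s /F1[_ cs']; rewrite /w indicE mem_set ?mulr1.
apply: ler_sum_uniq_sub => //.
  move=> s /F1[si _]; have : interior_faces M s by [].
  by rewrite IFE.
by move=> s _; rewrite /w mulr_ge0 /jump ?normr_ge0.
Qed.

End Path.

(** * Hausdorff measures of open sets *)

Section HausdorffBounds.
Variable R : realType.

Lemma leb_unit_ball_le (n : nat) :
  (leb R n (eball (0 : 'rV[R]_n) 1) <= (2 ^+ n)%:E)%E.
Proof.
rewrite -[2](mulr1 2) -(leb_cube 0 ler01); apply: le_measure; rewrite ?inE.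
- exact: measurable_eball.
- exact: measurable_cube.
- exact: eball_sub_cube.
Qed.

(** The gauge of a set is at most the [n]-th power of its diameter, because the
    unit ball is contained in a cube of side 2. *)
Lemma hausdorff_le (n d : nat) (A : set 'rV[R]_d) (B : \bar R) :
  (forall delta : R, 0 < delta -> exists2 U, hausdorff_cover delta A U &
    (\sum_(0 <= k <oo) (diam (U k) ^+ n)%:E <= B)%E) ->
  (hausdorff n A <= B)%E.
Proof.
move=> H; apply: ge_ereal_sup => _ [delta /= d0 <-].
have [U HU UB] := H _ d0; apply: ge_ereal_inf.
eexists; first by exists U; [exact: HU|reflexivity].
apply: le_trans UB; have dU k : 0 <= diam (U k).
  by apply: diam_ge0; have [] := HU.2 k.
apply: lee_nneseries => k _.
  by rewrite mule_ge0 ?measure_ge0// lee_fin exprn_ge0// divr_ge0.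
apply: (@le_trans _ _ ((2 ^+ n)%:E * ((diam (U k) / 2) ^+ n)%:E)%E).
  apply: lee_wpmul2r; last exact: leb_unit_ball_le.
  by rewrite lee_fin exprn_ge0// divr_ge0.
by rewrite -EFinM lee_fin -exprMn mulrC divfK.
Qed.

Lemma hausdorff_ge0 (n d : nat) (A : set 'rV[R]_d) : (0 <= hausdorff n A)%E.
Proof.
apply: (@le_trans _ _ (hausdorff_pre n 1 A)); last first.
  by apply: ereal_sup_ubound; exists 1 => /=.
apply: le_ereal_inf_tmp => _ [U [_ HU] <-]; apply: nneseries_ge0 => k _ _.
rewrite mule_ge0 ?measure_ge0// lee_fin exprn_ge0// divr_ge0//.
by apply: diam_ge0; have [] := HU k.
Qed.

(** By [hnull_leb], a null set is Lebesgue negligible. *)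
Lemma hausdorff_open_gt0 (n : nat) (D : set 'rV[R]_n) : (0 < n)%N ->
  open D -> D !=set0 -> (0 < hausdorff n D)%E.
Proof.
move=> n0 oD D0; rewrite lt_def hausdorff_ge0 andbT; apply/eqP.
move=> /(hausdorff_eq0_hnull n0)/hnull_leb; exact: not_negligible_open.
Qed.

Section Dyadic.
Variable n : nat.
Local Notation V := 'rV[R]_n.

Definition dyadic (m : nat) (x : V) : {ffun 'I_n -> int} :=
  [ffun i => Num.ceil (x ord0 i * 2 ^+ m)].

(** Dyadic cubes are nested: [ceil (a * 2 ^+ m')] is determined by the integers
    above it, and comparing [a * 2 ^+ m'] to an integer amounts to comparing
    [a * 2 ^+ m] to an integer. *)
Lemma dyadic_coarser m m' x y : (m' <= m)%N ->
  dyadic m x = dyadic m y -> dyadic m' x = dyadic m' y.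
Proof.
move=> mm' /ffunP E; apply/ffunP => i; have := E i; rewrite !ffunE => Ei.
suff H (a b : R) : Num.ceil (a * 2 ^+ m) = Num.ceil (b * 2 ^+ m) ->
    Num.ceil (a * 2 ^+ m') <= Num.ceil (b * 2 ^+ m').
  by apply/eqP; rewrite eq_le !H.
move=> ab; rewrite ceil_le_int.
have p2 : 0 < 2 ^+ (m - m') :> R by rewrite exprn_gt0.
rewrite -(ler_pM2r p2) -mulrA -exprD subnKC//.
have -> (z : int) : z%:~R * 2 ^+ (m - m') = (z * 2 ^+ (m - m'))%:~R :> R.
  by rewrite intrM rmorphXn.
rewrite -ceil_le_int ab ceil_le_int intrM rmorphXn/=.
have := ceil_ge (b * 2 ^+ m'); rewrite -(ler_pM2r p2) -mulrA -exprD subnKC//.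
Qed.

Lemma dyadic_cellE m z : [set x | dyadic m x = z] =
  [set v : V | forall i, (z i - 1)%:~R / 2 ^+ m < v ord0 i <= (z i)%:~R / 2 ^+ m].
Proof.
have p2 : 0 < 2 ^+ m :> R by rewrite exprn_gt0.
apply/seteqP; split => x /=.
  move=> <- i; rewrite ffunE ltr_pdivrMr// ler_pdivlMr//; exact: ceil_itv.
move=> H; apply/ffunP => i; rewrite ffunE; apply: ceil_def.
by rewrite -ltr_pdivrMr// -ler_pdivlMr//.
Qed.

Lemma dyadic_cell_leb m z :
  measurable ([set x | dyadic m x = z] : set (borelRV R n)) /\
  leb R n [set x | dyadic m x = z] = (((2 ^+ m)^-1) ^+ n)%:E.
Proof.
have p2 : 0 <= (2 ^+ m)^-1 :> R by rewrite invr_ge0 exprn_ge0.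
have H i : (z i - 1)%:~R / 2 ^+ m <= (z i)%:~R / 2 ^+ m :> R.
  by rewrite ler_wpM2r// ler_int gerBl.
rewrite dyadic_cellE; have [? ->] := leb_box H; split => //; congr EFin.
rewrite (eq_bigr (fun=> (2 ^+ m)^-1)); first by rewrite prodr_const card_ord.
by move=> i _; rewrite -mulrBl intrB opprB addrC subrK mul1r.
Qed.

Lemma dyadic_cell_diam m (x y : V) : dyadic m x = dyadic m y ->
  enorm (x - y) <= n%:R * (2 ^+ m)^-1.
Proof.
move=> /ffunP E; apply: enorm_le_coord => i; have := E i; rewrite !mxE !ffunE.
have := ceil_itv (x ord0 i * 2 ^+ m); have := ceil_itv (y ord0 i * 2 ^+ m).
move=> /andP[y1 y2] /andP[x1 x2] Ei; rewrite Ei in x1 x2.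
have p2 : 0 < 2 ^+ m :> R by rewrite exprn_gt0.
rewrite -[leRHS]mul1r ler_pdivlMr// -[X in _ * X](gtr0_norm p2) -normrM mulrBl.
rewrite intrB in y1 x1; move: x1 x2 y1 y2.
move: (x ord0 i * _) (y ord0 i * _) (_%:~R) => a b c *.
by rewrite ler_norml; apply/andP; split; lra.
Qed.

(** An open set is the disjoint union of the dyadic cubes of side at most
    [2 ^- m0] that are maximal among those that it contains, and the [n]-th power
    of the diameter of a cube is at most [n ^ n] times its measure. This compares
    the volumes of the diamonds, which are Hausdorff measures, to the Lebesgue
    measure with respect to which the gradient is integrated. *)
Lemma hausdorff_open_le (D : set V) : (0 < n)%N -> open D ->
  (hausdorff n D <= (n%:R ^+ n)%:E * leb R n D)%E.
Proof.
move=> n0 oD; apply: hausdorff_le => delta d0.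
have nR0 : 0 < n%:R :> R by rewrite ltr0n.
have [m0 m0d] : exists m0 : nat, n%:R * (2 ^+ m0)^-1 <= delta.
  have dn : 0 < delta / n%:R by exact: divr_gt0.
  have [k _ /(_ _ (leqnn _)) /= kP] := near_infty_natSinv_expn_lt (PosNum dn).
  by exists k; rewrite mulrC -ler_pdivlMr// ltW// -div1r.
pose good m x := (m0 <= m)%N /\ [set y | dyadic m y = dyadic m x] `<=` D.
(* [sel (m, z)] is the cube of index [z] at level [m] when this cube is maximal,
   and is empty otherwise *)
pose sel (p : nat * {ffun 'I_n -> int}) : set V :=
  [set x | [/\ dyadic p.1 x = p.2, good p.1 x &
     forall m', (m' < p.1)%N -> ~ good m' x]].
have selE p x : sel p x -> sel p = [set y | dyadic p.1 y = p.2].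
  move=> [xp gx nx]; apply/seteqP; split => y /=; first by case.
  move=> yp; have xy : dyadic p.1 y = dyadic p.1 x by rewrite yp.
  split => //; first by case: gx => g1 g2; split => //; rewrite xy.
  move=> m' m'p [g1 g2]; apply: (nx _ m'p); split => //.
  by rewrite -(dyadic_coarser (ltnW m'p) xy).
pose U (k : nat) : set V := oapp sel set0 (pickle_inv k).
have selm p : measurable (sel p : set (borelRV R n)) /\
    ((diam (sel p) ^+ n)%:E <= (n%:R ^+ n)%:E * leb R n (sel p))%E /\
    (bounded_set (sel p) /\ diam (sel p) <= delta).
  have [->|/set0P[x px]] := eqVneq (sel p) set0.
    rewrite measure0 mule0 diam_set0 expr0n eqn0Ngt n0; split => //; split => //.
    split; last exact: ltW.
    by apply/bounded_eball; exists 0.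
  have [mc lc] := dyadic_cell_leb p.1 p.2; rewrite (selE _ _ px).
  have dc : diam [set y | dyadic p.1 y = p.2] <= n%:R * (2 ^+ p.1)^-1.
    apply: diam_le; first by rewrite mulr_ge0// invr_ge0 exprn_ge0.
    by move=> y z /= yp zp; apply: dyadic_cell_diam; rewrite yp zp.
  have bc : bounded_set [set y : V | dyadic p.1 y = p.2].
    apply/bounded_eball; exists (enorm x + n%:R * (2 ^+ p.1)^-1) => y /= yp.
    rewrite -(subrK x y) (le_trans (enormD _ _))// addrC lerD2l.
    by apply: dyadic_cell_diam; rewrite yp; case: px.
  split => //; split; last first.
    split => //; apply: le_trans dc _; apply: le_trans m0d.
    rewrite ler_pM2l// lef_pV2 ?posrE ?exprn_gt0//.
    by rewrite ler_eXn2l ?ltr1n//; case: px => _ [].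
  have rhs0 : 0 <= n%:R * (2 ^+ p.1)^-1 :> R.
    by rewrite mulr_ge0// invr_ge0 exprn_ge0.
  by rewrite lc -EFinM lee_fin -exprMn lerXn2r// nnegrE; exact: diam_ge0.
have mU k : measurable (U k : set (borelRV R n)).
  by rewrite /U; case: (pickle_inv k) => [p|]//=; have [] := selm p.
exists U.
  split => [x Dx|k]; last first.
    rewrite /U; case: (pickle_inv k) => [p|]/=; first by have [_ []] := selm p.
    by rewrite diam_set0; split; [apply/bounded_eball; exists 0|exact: ltW].
  have ex_good : exists m, `[< good m x >].
    have [e e0 eD] := (nbhs_eball x D).1 (open_nbhs_nbhs (conj oD Dx)).
    have en : 0 < e / n%:R by exact: divr_gt0.
    have [k _ kP] := near_infty_natSinv_expn_lt (PosNum en).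
    exists (maxn m0 k); apply/asboolP; split; first exact: leq_maxl.
    move=> y /= yx; apply: eD; rewrite /eball/=.
    apply: le_lt_trans (dyadic_cell_diam yx) _.
    rewrite mulrC -ltr_pdivlMr// -div1r; apply: kP => /=; exact: leq_maxr.
  have [m1 /asboolP g1 min1] := ex_minnP ex_good.
  exists (pickle (m1, dyadic m1 x)) => //; rewrite /U pickleK_inv /=.
  split => //= m' m'1 gm'; have := min1 m' (introT (asboolP _) gm').
  by rewrite leqNgt m'1.
have tU : trivIset setT U.
  apply/trivIsetP => i j _ _ ij; apply/seteqP; split => // x.
  rewrite /U; have Ei := pickle_invK (T := (nat * {ffun 'I_n -> int})%type) i.
  have Ej := pickle_invK (T := (nat * {ffun 'I_n -> int})%type) j.
  move: Ei Ej ij; case: (pickle_inv i) => [p|]//=; last by move=> _ _ _ [].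
  case: (pickle_inv j) => [q|]//=; last by move=> _ _ _ [].
  move=> <- <- /eqP pq [[xp gp np] [xq gq nq]]; apply: pq; congr pickle.
  have pq1 : p.1 = q.1.
    have [lt|lt|//] := ltngtP p.1 q.1.
      by case: (nq _ lt).
    by case: (np _ lt).
  have pq2 : p.2 = q.2 by rewrite -xp -xq pq1.
  by rewrite [p]surjective_pairing [q]surjective_pairing pq1 pq2.
apply: (@le_trans _ _ (\sum_(0 <= k <oo) (n%:R ^+ n)%:E * leb R n (U k))%E).
  apply: lee_nneseries => k _; first by rewrite lee_fin exprn_ge0// diam_ge0//;
    rewrite /U; case: (pickle_inv k) => [p|]/=; [have [_ [_ []]] := selm p|
      apply/bounded_eball; exists 0].
  rewrite /U; case: (pickle_inv k) => [p|]/=; first by have [_ []] := selm p.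
  by rewrite measure0 mule0 diam_set0 expr0n eqn0Ngt n0.
rewrite nneseriesZl; last by move=> k _; exact: measure_ge0.
apply: lee_wpmul2l; first by rewrite lee_fin exprn_ge0.
have mUU : measurable (\bigcup_k U k : set (borelRV R n)) by exact: bigcupT_measurable.
rewrite -(measure_semi_bigcup (leb R n) mU tU mUU).
apply: le_measure; rewrite ?inE//; first exact: measurable_open_RV.
move=> x [k _]; rewrite /U; case: (pickle_inv k) => [p|]//= [_ [_ gD] _].
exact: gD.
Qed.

End Dyadic.
End HausdorffBounds.

(** * Hyperplanes *)

Section Hyperplanes.
Variables (R : realType) (n : nat).
Local Notation V := 'rV[R]_n.+1.

(** The coordinate [i] of a point of the hyperplane is a Lipschitz function of
    the others when [a ord0 i != 0]; cutting the range of these [n] coordinates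
    into [N] intervals covers the bounded part by [N ^ n] small sets. *)
Lemma hyperplane_cover (a : V) (b B : R) : a != 0 ->
  exists2 C : R, 0 < C & forall N : nat, (0 < N)%N -> exists U : nat -> set V,
    [/\ [set x | dotv a x = b /\ enorm x <= B] `<=` \bigcup_(k < N ^ n) U k,
        forall k x y, U k x -> U k y -> enorm (x - y) <= C / N%:R &
        forall k, (N ^ n <= k)%N -> U k = set0].
Proof.
move=> a0; have [i ai0] : exists i, a ord0 i != 0.
  apply: contrapT => H; move/eqP: a0; apply; apply/rowP => i; rewrite mxE.
  by apply: contrapT => /eqP ai; apply: H; exists i.
pose L : R := 1 + \sum_(j < n) `|a ord0 (lift i j)| / `|a ord0 i|.
have L1 : 1 <= L by rewrite lerDl sumr_ge0// => j _; rewrite divr_ge0.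
have L0 : 0 < L by exact: lt_le_trans L1.
pose B' : R := `|B| + 1; have B'0 : 0 < B' by rewrite ltr_wpDl.
pose C : R := n.+1%:R * (L * (2 * B')).
have C0 : 0 < C by rewrite mulr_gt0// mulr_gt0// mulr_gt0.
exists C => // N N0; have NR0 : 0 < N%:R :> R by rewrite ltr0n.
pose dl : R := 2 * B' / N%:R; have dl0 : 0 < dl by rewrite divr_gt0// mulr_gt0.
pose I : finType := {ffun 'I_n -> 'I_N}.
have cardI : #|{: I}| = (N ^ n)%N by rewrite card_ffun !card_ord.
pose W (z : I) : set V := [set x | dotv a x = b /\
  forall j, (z j)%:R * dl <= x ord0 (lift i j) + B' < (z j).+1%:R * dl].
pose U k := oapp (fun k' : 'I_#|{: I}| => W (enum_val k')) set0 (insub k).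
exists U; split.
- move=> x [axb xB].
  have xj j : 0 <= x ord0 (lift i j) + B' < N%:R * dl.
    have := le_trans (coord_le_enorm x (lift i j)) (le_trans xB (ler_norm B)).
    rewrite ler_norml => /andP[h1 h2]; apply/andP; split; first by rewrite /B'; lra.
    by rewrite /dl mulrC divfK ?gt_eqF// /B'; lra.
  have q0 j : 0 <= (x ord0 (lift i j) + B') / dl.
    by have /andP[? _] := xj j; rewrite divr_ge0// ltW.
  have zN j : (Num.trunc ((x ord0 (lift i j) + B') / dl) < N)%N.
    have /andP[t1 _] := truncn_itv (q0 j); rewrite -(ltr_nat R).
    by apply: le_lt_trans t1 _; rewrite ltr_pdivrMr//; have /andP[] := xj j.
  pose z : I := [ffun j => Ordinal (zN j)].
  have kN : (enum_rank z < N ^ n)%N by rewrite -[X in (_ < X)%N]cardI.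
  exists (enum_rank z : nat) => //; rewrite /U valK/= enum_rankK.
  split => // j; rewrite ffunE /= -ler_pdivlMr// -ltr_pdivrMr//.
  exact: truncn_itv.
- move=> k x y; rewrite /U; case: insub => [k'|]//=.
  move=> [ax xz] [ay yz].
  have xyj j : `|x ord0 (lift i j) - y ord0 (lift i j)| <= dl.
    have := xz j; have := yz j; rewrite -natr1 mulrDl mul1r.
    move: (_%:R * dl) (x _ _) (y _ _) => c p q /andP[y1 y2] /andP[x1 x2].
    by rewrite ler_norml; apply/andP; split; lra.
  have xyi : `|x ord0 i - y ord0 i| <= L * dl.
    have : dotv a (x - y) = 0 by rewrite dotvDr dotvNr ax ay subrr.
    rewrite /dotv (bigD1_ord i)//= => /eqP; rewrite addr_eq0 => /eqP E.
    have ai : 0 < `|a ord0 i| by rewrite normr_gt0.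
    rewrite -(ler_pM2l ai) -normrM.
    have -> : a ord0 i * (x ord0 i - y ord0 i) = a ord0 i * (x - y) ord0 i.
      by rewrite !mxE.
    rewrite E normrN; apply: le_trans (ler_norm_sum _ _ _) _.
    apply: (@le_trans _ _ (\sum_(j < n) `|a ord0 (lift i j)| * dl)).
      by apply: ler_sum => j _; rewrite normrM ler_wpM2l// !mxE.
    rewrite -mulr_suml (mulrA _ L dl); apply: ler_wpM2r; first exact: ltW.
    rewrite /L mulrDr mulr1 mulr_sumr -[leLHS]add0r lerD//.
    by apply: ler_sum => j _; rewrite mulrCA divff ?mulr1// gt_eqF.
  have -> : C / N%:R = n.+1%:R * (L * dl).
    by rewrite /C /dl -!mulrA.
  apply: enorm_le_coord => j; rewrite !mxE.
  case: (unliftP i j) => [j' ->|->]//.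
  by rewrite (le_trans (xyj j'))// ler_peMl// ltW.
- by move=> k Nk; rewrite /U insubN// -leqNgt cardI.
Qed.

(** The [N ^ n] sets of [hyperplane_cover] have gauges of order [N ^- n]. *)
Lemma hyperplane_hausdorff_lty (a : V) (b : R) (A : set V) : (0 < n)%N ->
  a != 0 -> bounded_set A -> (forall x, A x -> dotv a x = b) ->
  (hausdorff n A < +oo)%E.
Proof.
move=> n0 a0 /bounded_eball[B AB] Ab.
have [C C0 HC] := hyperplane_cover b B a0.
apply: (@le_lt_trans _ _ (C ^+ n)%:E); last exact: ltry.
apply: hausdorff_le => delta d0.
have [N0 N0d] := ltr_add_invr (divr_gt0 d0 C0); rewrite add0r in N0d.
pose N := N0.+1; have NR0 : 0 < N%:R :> R by rewrite ltr0n.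
have [U [cU dU U0]] := HC N isT.
have Cd : C / N%:R <= delta.
  by rewrite mulrC -ler_pdivlMr// ltW.
have CN0 : 0 <= C / N%:R by rewrite divr_ge0// ltW.
have bU k : bounded_set (U k).
  have [->|/set0P[c Uc]] := eqVneq (U k) set0; apply/bounded_eball; first by exists 0.
  exists (enorm c + C / N%:R) => x Ux; rewrite -(subrK c x).
  by rewrite (le_trans (enormD _ _))// addrC lerD2l (dU k).
have diamU k : diam (U k) <= C / N%:R by apply: diam_le => // x y; exact: dU.
exists U.
  split=> [x Ax|k]; last by split => //; exact: le_trans (diamU k) Cd.
  by have [k _ Uk] := cU x (conj (Ab _ Ax) (AB _ Ax)); exists k.
rewrite (nneseries_split 0 (N ^ n)); last first.
  by move=> k _; rewrite lee_fin exprn_ge0// diam_ge0.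
rewrite [X in (_ + X)%E]eseries0 ?adde0; last first.
  by move=> k Nk _; rewrite U0// diam_set0 expr0n eqn0Ngt n0.
rewrite add0n big_mkord sumEFin lee_fin.
apply: (@le_trans _ _ (\sum_(k < N ^ n) (C / N%:R) ^+ n)).
  by apply: ler_sum => k _; apply: lerXn2r; rewrite ?nnegrE ?diam_ge0.
rewrite sumr_const card_ord -[leLHS]mulr_natl expr_div_n natrX mulrC divfK//.
by rewrite expf_eq0 gt_eqF// andbF.
Qed.

(** In dimension [n.+1], the [N ^ n] sets of [hyperplane_cover] are contained in
    cubes of measures of order [N ^- n.+1]. *)
Lemma hyperplane_negligible (a : V) (b : R) : a != 0 ->
  (leb R n.+1).-negligible [set x | dotv a x = b].
Proof.
move=> a0.
have -> : [set x | dotv a x = b] =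
    \bigcup_(m : nat) [set x : V | dotv a x = b /\ enorm x <= m%:R].
  apply/seteqP; split => x /=; last by move=> [m _ []].
  move=> axb; exists (Num.trunc (enorm x)).+1 => //; split => //.
  by have /andP[_ /ltW] := truncn_itv (enorm_ge0 x).
apply: negligible_bigcup => m; apply: negligible_small => e e0.
have [C C0 HC] := hyperplane_cover b m%:R a0.
have K0 : 0 < (4 * C) ^+ n.+1 by rewrite exprn_gt0// mulr_gt0.
have [N0 N0e] := ltr_add_invr (divr_gt0 e0 K0); rewrite add0r in N0e.
pose N := N0.+1; have NR0 : 0 < N%:R :> R by rewrite ltr0n.
have [U [cU dU U0]] := HC N isT.
have CN0 : 0 < C / N%:R by rewrite divr_gt0.
have CN20 : 0 <= 2 * (C / N%:R) by rewrite mulr_ge0// ltW.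
pose T k := cube (xget 0 (U k)) (2 * (C / N%:R)).
exists (\big[setU/set0]_(k < N ^ n) T k); split.
- by apply: bigsetU_measurable => k _; exact: measurable_cube.
- move=> x /cU[k /= kN Ux]; rewrite -(bigcup_mkord _ T); exists k => //.
  apply: eball_sub_cube; apply: (@le_lt_trans _ _ (C / N%:R)).
    by apply: (dU k) => //; exact: xgetPex (ex_intro _ x Ux).
  by rewrite ltr_pMl// ltr1n.
- apply: (le_trans (Boole_inequality _ _)).
    by move=> k _; exact: measurable_cube.
  rewrite (eq_bigr (fun=> ((2 * (2 * (C / N%:R))) ^+ n.+1)%:E)); last first.
    by move=> k _; exact: leb_cube.
  rewrite sumEFin lee_fin sumr_const card_ord -[leLHS]mulr_natl.
  have -> : 2 * (2 * (C / N%:R)) = 4 * C / N%:R by field; rewrite gt_eqF.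
  rewrite expr_div_n natrX.
  have -> : N%:R ^+ n * ((4 * C) ^+ n.+1 / N%:R ^+ n.+1) = (4 * C) ^+ n.+1 / N%:R.
    move: (gt_eqF NR0) ((4 * C) ^+ _); move: (N%:R : R) => q q0 K.
    have qn : q ^+ n != 0 by rewrite expf_neq0// q0.
    rewrite (exprS q); move: (q ^+ n) qn => p p0.
    by field; rewrite q0 p0.
  by rewrite mulrC -ler_pdivlMr// ltW.
Qed.

End Hyperplanes.

(** * Solid angles *)

(** The integral of a nonnegative function is a supremum over the simple
    functions below it, which makes it monotone on all functions. *)
Lemma ge0_le_integral_nonmeasurable d (T : measurableType d) (R : realType)
    (mu : {measure set T -> \bar R}) (D : set T) (f g : T -> \bar R) :
  (forall x, D x -> (0 <= f x)%E) -> (forall x, D x -> (f x <= g x)%E) ->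
  (\int[mu]_(x in D) f x <= \int[mu]_(x in D) g x)%E.
Proof.
move=> f0 fg; have g0 x : D x -> (0 <= g x)%E.
  by move=> Dx; exact: le_trans (f0 x Dx) (fg x Dx).
rewrite !ge0_integralE//; apply: ge_ereal_sup => _ [k /= kf <-].
apply: ereal_sup_ubound; exists k => // x; apply: le_trans (kf x) _; rewrite /patch.
by case: ifPn => //; rewrite inE; exact: fg.
Qed.

Section ShadowEstimate.
Variables (R : realType) (n : nat).
Local Notation V := 'rV[R]_n.+1.

(** If [x] is within [2 * h] of [p], the whole ball is an adequate [T], and [A] can
    be chosen of order [h]. If [x] is farther, [U] is seen from [x] under an angle
    of order [h / D], where [D] is the distance to [p], and [A] is chosen of order
    [D]. In both cases the solid angle is bounded in terms of the distance [A] at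
    which the singular kernel will be evaluated. *)
Lemma shadow_estimate (x p : V) (U E : set V) (rho h : R) : 0 < rho -> 0 < h ->
  (forall q, U q -> enorm (q - p) <= h) -> (forall q, E q -> enorm (q - p) <= h) ->
  exists (T : set V) (A : R), [/\ measurable (T : set (borelRV R n.+1)), 0 < A,
    shadow x U `&` [set y | enorm (y - x) <= rho] `<=` T,
    forall q, E q -> enorm (x - q) <= A &
    (leb R n.+1 T <= ((24 * rho) ^+ n.+1 * (h / A) ^+ n)%:E)%E].
Proof.
move=> rho0 h0 Up Ep; pose D := enorm (p - x).
have D0 : 0 <= D by exact: enorm_ge0.
have xq q : enorm (q - p) <= h -> enorm (x - q) <= D + h.
  move=> qp; rewrite enormB -(subrKA p) (le_trans (enormD _ _))// addrC.
  by rewrite lerD2l.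
have [D2|D2] := leP D (2 * h).
  have r20 : 0 <= 2 * rho by rewrite mulr_ge0// ltW.
  exists (cube x (2 * rho)), (3 * h); split.
  - exact: measurable_cube.
  - by rewrite mulr_gt0.
  - move=> y [_ /= yx]; apply: eball_sub_cube; apply: le_lt_trans yx _.
    by rewrite ltr_pMl// ltr1n.
  - move=> q /Ep/xq; lra.
  rewrite leb_cube// lee_fin.
  have -> : h / (3 * h) = 3^-1 by field; rewrite gt_eqF.
  have -> : 2 * (2 * rho) = 4 * rho by ring.
  have -> : 24 * rho = 6 * (4 * rho) by ring.
  have w0 : 0 <= (4 * rho) ^+ n.+1 by rewrite exprn_ge0// mulr_ge0// ltW.
  rewrite [(6 * _) ^+ _]exprMn mulrAC ler_peMl// exprS -mulrA -exprMn.
  have e1 : 1 <= (6 * 3^-1) ^+ n :> R by rewrite exprn_ege1//; lra.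
  lra.
have D_gt0 : 0 < D by apply: lt_trans D2; rewrite mulr_gt0.
have D20 : 0 < D / 2 by rewrite divr_gt0.
have [|T [mT ST TM]] := @shadow_cover _ _ x p U rho (D / 2) D h
    D20 h0 rho0 _ Up (lexx D).
- move=> q /Up qp; have := ler_enorm_dist (p - x) (q - x).
  by rewrite opprB addrA subrK -/D (enormB p q) => H; lra.
exists T, (2 * D); split => //.
- by rewrite mulr_gt0.
- by move=> q /Ep/xq; lra.
apply: le_trans TM _; rewrite lee_fin.
have -> : 6 * (rho / (D / 2) * h) = 12 * rho * (h / D) by field; rewrite gt_eqF.
have -> : 24 * rho = 2 * (12 * rho) by ring.
have -> : h / (2 * D) = (h / D) / 2 by field; rewrite gt_eqF.
rewrite (exprMn _ 2) (exprMn _ (12 * rho)) [(h / D / 2) ^+ n]expr_div_n.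
rewrite (exprS 2) (exprS (h / D)).
have w1 : 2 * (h / D) <= 1 :> R by rewrite mulrA ler_pdivrMr// mul1r ltW.
have w0 : 0 <= h / D by rewrite divr_ge0// ltW.
have -> : (D / h + 2) * ((12 * rho) ^+ n.+1 * (h / D * (h / D) ^+ n)) =
  (1 + 2 * (h / D)) * ((12 * rho) ^+ n.+1 * (h / D) ^+ n).
  have Dh : D / h * (h / D) = 1 by rewrite mulrA divfK ?divff// gt_eqF.
  by rewrite -[X in X + 2 * _]Dh; ring.
have -> : 2 * 2 ^+ n * (12 * rho) ^+ n.+1 * ((h / D) ^+ n / 2 ^+ n) =
  2 * ((12 * rho) ^+ n.+1 * (h / D) ^+ n) :> R.
  have p2 : 2 ^+ n != 0 :> R by rewrite expf_neq0.
  by move: (2 ^+ n) p2 ((12 * rho) ^+ _) ((h / D) ^+ _) => a a0 b c; field.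
rewrite ler_wpM2r; last by lra.
  by [].
by rewrite mulr_ge0 ?exprn_ge0// mulr_ge0// ltW.
Qed.

(** All the cones contain a cube of the same size; averaging over this cube
    instead of the cone avoids the rotation invariance of the measure. *)
Lemma cone_cube (theta rho : R) (x e : V) : 0 < theta < pi / 2 -> 0 < rho ->
  enorm e = 1 ->
  cube (x + (rho / 2) *: e) (rho * (1 - cos theta) / 8 / n.+2%:R) `<=`
    cone theta rho x e.
Proof.
move=> th rho0 e1.
have s0 : 0 < sin theta by exact: sin_gt0_pihalf.
have c1 : cos theta < 1.
  rewrite lt_neqAle cos_le1 andbT; apply/eqP => c1.
  by have := sin2cos2 theta; rewrite c1 expr1n subrr => /eqP; rewrite sqrf_eq0 gt_eqF.
have c0 : 0 < cos theta.
  apply: cos_gt0_pihalf; move: th => /andP[t0 ->]; rewrite andbT.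
  by rewrite (lt_trans _ t0)// oppr_lt0 divr_gt0// pi_gt0.
have r0 : 0 < rho * (1 - cos theta) / 8.
  by rewrite divr_gt0// mulr_gt0// subr_gt0.
move=> y /(cube_sub_eball r0); rewrite /eball/= => yc.
set c := x + _ in yc; set r := _ / 8 in r0 yc.
have yx : enorm (y - x) <= r + rho / 2.
  rewrite -(subrKA c) (le_trans (enormD _ _))// lerD ?(ltW yc)//.
  by rewrite /c addrC addKr enormZ e1 mulr1 gtr0_norm// divr_gt0.
have rrho : r <= rho * (1 - cos theta) / 8 by [].
have rc : 0 < rho * cos theta by exact: mulr_gt0.
split; first by apply: le_lt_trans yx _; rewrite /r; lra.
have dy : rho / 2 - r < dotv (y - x) e.
  rewrite -(subrKA c) dotvDl.
  have -> : c - x = (rho / 2) *: e by rewrite /c addrC addKr.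
  rewrite dotvZl -enorm_sqr e1 expr1n mulr1.
  have := dotv_le (- (y - c)) e; rewrite dotvNl enormN e1 mulr1.
  clearbody r; lra.
apply: le_lt_trans dy.
apply: (@le_trans _ _ (cos theta * (r + rho / 2))).
  by rewrite ler_wpM2l// ltW.
have cr : cos theta * r <= r by rewrite ler_piMl// ltW.
rewrite mulrDr; move: cr; rewrite /r; lra.
Qed.

End ShadowEstimate.

(** * Measures of faces and diamonds *)

Section Estimate.
Variables (R : realType) (n : nat).
Local Notation V := 'rV[R]_n.+1.
Variables (Omega : set V) (M : mesh Omega) (mu lambda : R).
Hypotheses (n0 : (0 < n)%N) (oO : open Omega) (bO : bounded_set Omega).
Hypotheses (mu0 : 0 < mu) (lambda0 : 0 < lambda) (reg : regular_mesh M mu lambda).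
Local Notation h := (mesh_size M).

Let star := reg.1.

Definition unit_ball_hausdorff : R :=
  fine (hausdorff n (eball (0 : 'rV[R]_n) 1)).

Lemma unit_ball_hausdorff_gt0 : 0 < unit_ball_hausdorff /\
  hausdorff n (eball (0 : 'rV[R]_n) 1) = unit_ball_hausdorff%:E.
Proof.
have H0 : (0 < hausdorff n (eball (0 : 'rV[R]_n) 1))%E.
  apply: hausdorff_open_gt0 => //; first exact: open_eball.
  by exists 0; rewrite /eball/= subrr enorm0.
have Hoo : (hausdorff n (eball (0 : 'rV[R]_n) 1) < +oo)%E.
  apply: le_lt_trans (hausdorff_open_le n0 (@open_eball _ _ _ _)) _.
  apply: lte_mul_pinfty; rewrite ?lee_fin ?exprn_ge0//.
  by apply: le_lt_trans (leb_unit_ball_le R n) _; exact: ltry.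
have Hfin : hausdorff n (eball (0 : 'rV[R]_n) 1) \is a fin_num.
  by rewrite ge0_fin_numE// ltW.
by rewrite /unit_ball_hausdorff fineK//; split => //; apply: fine_gt0; rewrite H0.
Qed.

(** Finiteness matters as much as the lower bound: the discrete gradient uses the
    real number [fine (hausdorff n s)]. *)
Lemma face_measure s : faces M s -> exists2 m : R,
  (lambda * h) ^+ n * unit_ball_hausdorff <= m & hausdorff n s = m%:E.
Proof.
move=> fs; have [a [b [U [a0 oU sE]]]] := faceP fs.
have := fs; rewrite mesh_faces => -[K cK fK].
have bs : bounded_set s.
  have [B HB] := (bounded_eball Omega).1 bO.
  apply/bounded_eball; have c := mesh_center cK.
  exists (enorm (center M K) + h) => x sx.
  rewrite -(subrK (center M K) x) (le_trans (enormD _ _))// addrC lerD2l.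
  apply: (cell_dist_le bO cK); last exact: subset_closure.
  by have [] := face_sub_boundary cK fK sx.
have soo : (hausdorff n s < +oo)%E.
  by apply: (hyperplane_hausdorff_lty n0 a0 bs (b := b)) => x; rewrite sE => -[].
have sfin : hausdorff n s \is a fin_num by rewrite ge0_fin_numE// hausdorff_ge0.
exists (fine (hausdorff n s)); last by rewrite fineK.
rewrite -lee_fin fineK// exprMn EFinM -unit_ball_hausdorff_gt0.2.
exact: reg.2.
Qed.

(** In the discrete gradient the jump is divided by [H], but the gradient is
    integrated over a set of measure [l]. *)
Lemma diamond_measure s : interior_faces M s -> exists l H : R,
  [/\ 0 < l, 0 < H, leb R n.+1 (diamond M s) = l%:E,
     hausdorff n.+1 (diamond M s) = H%:E & H <= n.+1%:R ^+ n.+1 * l].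
Proof.
move=> ints; have D0 := diamond_neq0 bO mu0 star ints.
have oD := @diamond_open _ _ _ M s.
have [c1 c2 _ _ _] := adjacentP ints.
have [B HB] := (bounded_eball Omega).1 bO.
have mD := measurable_open_RV oD.
have loo : (leb R n.+1 (diamond M s) < +oo)%E.
  apply: (@le_lt_trans _ _ (leb R n.+1 (cube 0 (`|B| + 1)))); last first.
    by rewrite leb_cube ?ltry// addr_ge0.
  apply: le_measure; rewrite ?inE//; first by apply: measurable_cube; rewrite addr_ge0.
  apply: subset_trans (@eball_sub_cube _ _ _ _) => x Dx; rewrite /eball/= subr0.
  have cB K : cells M K -> closure K x -> enorm x < `|B| + 1.
    move=> cK /closure_eball/(_ _ ltr01)[y Ky yx].
    rewrite -(subrK y x) (le_lt_trans (enormD _ _))// enormB addrC ler_ltD//.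
    by rewrite (le_trans (HB _ (subset_cell cK Ky)))// ler_norm.
  by have [] := diamond_sub bO mu0 star ints Dx; exact: cB.
have l0 : (0 < leb R n.+1 (diamond M s))%E.
  rewrite measure_gt0; apply/eqP => E; apply: (not_negligible_open oD D0).
  by exists (diamond M s); split.
have lfin : leb R n.+1 (diamond M s) \is a fin_num by rewrite ge0_fin_numE// ltW.
have H0 : (0 < hausdorff n.+1 (diamond M s))%E by exact: hausdorff_open_gt0.
have Hle := hausdorff_open_le (ltn0Sn n) oD.
have Hoo : (hausdorff n.+1 (diamond M s) < +oo)%E.
  by apply: le_lt_trans Hle _; apply: lte_mul_pinfty; rewrite ?lee_fin ?exprn_ge0.
have Hfin : hausdorff n.+1 (diamond M s) \is a fin_num by rewrite ge0_fin_numE// ltW.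
exists (fine (leb R n.+1 (diamond M s))), (fine (hausdorff n.+1 (diamond M s))).
rewrite !fineK//; split => //.
- by apply: fine_gt0; rewrite l0.
- by apply: fine_gt0; rewrite H0.
- by rewrite -lee_fin EFinM !fineK.
Qed.

Variable (u : set V -> R).

Definition jump (s : set V) : R := `|u (adjacent M s).2 - u (adjacent M s).1|.

(** The coefficient of the unit normal in the discrete gradient on the diamond. *)
Definition slope (s : set V) : R :=
  fine (hausdorff n s) * ((u (adjacent M s).2 - u (adjacent M s).1)
       / fine (hausdorff n.+1 (diamond M s))).

(** The product of the constants of [shadow_estimate] and [hausdorff_open_le],
    divided by the constant of the lower bound on the measures of the faces. *)
Definition face_const (rho : R) : R :=
  (24 * rho) ^+ n.+1 * n.+1%:R ^+ n.+1 / (lambda ^+ n * unit_ball_hausdorff).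

(** The comparison on which the representation formula rests. The measure of
    the shadow of a face is of order [(h / A) ^+ n], by [shadow_estimate], and the
    regularity of the mesh bounds [h ^+ n] by the measure of the face. *)
Lemma face_estimate (x : V) (s : set V) (rho : R) : 0 < rho -> interior_faces M s ->
  exists (T : set V) (A : R), [/\ measurable (T : set (borelRV R n.+1)), 0 < A,
    shadow x (closure s) `&` [set y | enorm (y - x) <= rho] `<=` T,
    forall xi, diamond M s xi -> enorm (x - xi) <= A &
    ((jump s)%:E * leb R n.+1 T <= (face_const rho)%:E *
      ((`|slope s| / A ^+ n)%:E * leb R n.+1 (diamond M s)))%E].
Proof.
move=> rho0 ints; have [c1 c2 _ f1 f2] := adjacentP ints.
have h0 := mesh_size_gt0 bO c1.
have [[p sp] _ _ _] := mesh_face ints.1.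
have cp K : cells M K -> faces_of M K s -> closure K p.
  by move=> cK fK; have [] := face_sub_boundary cK fK sp.
have [|q|T [A [mT A0 ST DA TA]]] := @shadow_estimate _ _ x p (closure s) (diamond M s)
  rho h rho0 h0.
- move=> q sq; apply: (cell_dist_le bO c1); last exact: cp.
  by have [] := face_boundary c1 f1 sq.
- move=> /(diamond_sub bO mu0 star ints)[qK|qL].
    by apply: (cell_dist_le bO c1) => //; exact: cp.
  by apply: (cell_dist_le bO c2) => //; exact: cp.
exists T, A; split => //.
have [l [H [l0 H0 lE HE Hl]]] := diamond_measure ints.
have [m mge mE] := face_measure ints.1.
have [B0 BE] := unit_ball_hausdorff_gt0.
have J0 : 0 <= jump s by exact: normr_ge0.
apply: (@le_trans _ _ ((jump s)%:E * ((24 * rho) ^+ n.+1 * (h / A) ^+ n)%:E)%E).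
  by apply: lee_wpmul2l => //; rewrite lee_fin.
rewrite lE -!EFinM lee_fin /slope mE HE /= normrM normrM normfV.
rewrite (gtr0_norm H0) -/(jump s) /face_const.
have An : 0 < A ^+ n by exact: exprn_gt0.
have ln : 0 < lambda ^+ n by exact: exprn_gt0.
have hn : 0 < h ^+ n by exact: exprn_gt0.
have m0 : 0 <= m.
  by apply: le_trans mge; rewrite mulr_ge0 ?(ltW B0)// exprn_ge0// mulr_ge0// ltW.
rewrite (ger0_norm m0) (expr_div_n h); rewrite exprMn in mge.
have r0 : 0 <= (24 * rho) ^+ n.+1 by rewrite exprn_ge0// mulr_ge0// ltW.
have Kge : h ^+ n <= m / (lambda ^+ n * unit_ball_hausdorff).
  by rewrite ler_pdivlMr ?mulr_gt0// mulrA (mulrC (h ^+ n)).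
have lH : 1 <= n.+1%:R ^+ n.+1 * l / H by rewrite ler_pdivlMr// mul1r.
have -> : (24 * rho) ^+ n.+1 * n.+1%:R ^+ n.+1 / (lambda ^+ n * unit_ball_hausdorff) *
    (m * (jump s / H) / A ^+ n * l) =
  jump s * ((24 * rho) ^+ n.+1 * (m / (lambda ^+ n * unit_ball_hausdorff) / A ^+ n)) *
    (n.+1%:R ^+ n.+1 * l / H).
  by field; rewrite !gt_eqF.
rewrite -[leLHS]mulr1; apply: ler_pM => //.
- by rewrite mulr_ge0// mulr_ge0// divr_ge0// ltW.
- by rewrite ler_wpM2l// ler_wpM2l// ler_wpM2r// invr_ge0 ltW.
Qed.

End Estimate.

(** * Almost everywhere properties *)

Lemma finite_uniq_seq (T : eqType) (A : set T) : finite_set A ->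
  exists2 s : seq T, uniq s & A = [set` s].
Proof.
move=> /finite_seqP[s ->]; exists (undup s); first exact: undup_uniq.
by apply/seteqP; split => x /=; rewrite mem_undup.
Qed.

Lemma negligible_bigcup_seq d (T : measurableType d) (R : realType)
    (mu : {measure set T -> \bar R}) (I : eqType) (s : seq I) (F : I -> set T) :
  (forall i, i \in s -> mu.-negligible (F i)) ->
  mu.-negligible (\bigcup_(i in [set` s]) F i).
Proof.
move=> HF; elim: s HF => [|i s IH] HF.
  by rewrite (_ : \bigcup_(i in _) _ = set0) ?bigcup_set0//;
    [exact: negligible_set0|apply/seteqP; split => // x []].
apply: (@negligibleS _ _ _ _ (F i `|` \bigcup_(i in [set` s]) F i)).
  move=> x [j /=]; rewrite in_cons => /orP[/eqP-> Fx|js Fx]; first by left.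
  by right; exists j.
apply: negligibleU; first by apply: HF; rewrite mem_head.
by apply: IH => j js; apply: HF; rewrite in_cons js orbT.
Qed.

Section LocalEstimate.
Variables (R : realType) (n : nat).
Local Notation V := 'rV[R]_n.+1.
Variables (Omega : set V) (M : mesh Omega) (mu lambda : R).
Hypotheses (n0 : (0 < n)%N) (oO : open Omega) (bO : bounded_set Omega).
Hypotheses (mu0 : 0 < mu) (lambda0 : 0 < lambda) (reg : regular_mesh M mu lambda).
Local Notation h := (mesh_size M).

Let star := reg.1.

(** The boundaries are covered by the finitely many hyperplanes of the faces. *)
Lemma boundary_negligible :
  (leb R n.+1).-negligible (\bigcup_(K in cells M) boundary K).
Proof.
have [fs _ fsE] := finite_uniq_seq (faces_finite M).
have : (leb R n.+1).-negligible (\bigcup_(s in [set` fs]) closure s).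
  apply: negligible_bigcup_seq => s; have -> : (s \in fs) = (s \in [set` fs]) :> Prop.
    by rewrite inE.
  rewrite inE -fsE => /faceP[a [b [U [a0 _ ->]]]].
  apply: negligibleS (hyperplane_negligible b a0).
  rewrite -[X in _ `<=` X](_ : closure [set x | dotv a x = b] = _).
    by apply: closure_subset => x [].
  symmetry; apply/closure_id; apply: (@closed_comp _ _ (dotv a) [set t | t = b]).
    by move=> x _; exact: dotv_continuous.
  exact: closed_eq.
apply: negligibleS => x [K cK]; rewrite (mesh_boundary cK) => -[s fK sx].
by exists s => //; rewrite -fsE; exact: face_in_faces fK.
Qed.

Lemma singleton_negligible (x : V) : (leb R n.+1).-negligible [set x].
Proof.
pose v : V := const_mx 1.
have v0 : v != 0.
  by apply/eqP => /rowP/(_ ord0); rewrite !mxE => /eqP; rewrite oner_eq0.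
by apply: negligibleS (hyperplane_negligible (dotv v x) v0) => y ->.
Qed.

(** These are the [y] to which [segment_jump] does not apply. Since [x] is in the
    open cell [K0], it is at positive distance from all the boundaries, so
    [hnull_shadow] applies to each null contact. *)
Lemma bad_targets_negligible (K0 : set V) (x : V) (rho : R) : cells M K0 -> K0 x ->
  (leb R n.+1).-negligible (\bigcup_(K in cells M) \bigcup_(L in cells M)
    [set y | hausdorff n (closure K `&` boundary L) = 0%E /\
      (shadow x (closure K `&` boundary L) `&` [set y | enorm (y - x) <= rho]) y]).
Proof.
move=> cK0 K0x.
have [cs _ csE] := finite_uniq_seq (cells_finite M).
have inC K : K \in cs -> cells M K by rewrite csE.
rewrite {1}csE; apply: negligible_bigcup_seq => K /inC cK.
rewrite csE; apply: negligible_bigcup_seq => L /inC cL.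
have [H0|H0] := pselect (hausdorff n (closure K `&` boundary L) = 0%E); last first.
  by apply: negligibleS (negligible_set0 _) => y [].
have [r r0 rK0] := (nbhs_eball _ _).1 (open_nbhs_nbhs (conj (open_cell cK0) K0x)).
suff : (leb R n.+1).-negligible (shadow x (closure K `&` boundary L) `&`
  [set y | enorm (y - x) <= rho]) by apply: negligibleS => y [].
apply: (@hnull_shadow R n _ x rho r) => //.
- exact: hausdorff_eq0_hnull.
- apply/bounded_eball; exists (enorm (center M K) + h) => y [Ky _].
  rewrite -(subrK (center M K) y) (le_trans (enormD _ _))// addrC lerD2l.
  apply: (cell_dist_le bO cK) => //; apply: subset_closure; exact: mesh_center.
move=> q [_ Lq]; rewrite leNgt; apply/negP => qr.
have K0q : K0 q by apply: rK0.
have [w [Lw K0w]] := Lq.1 _ (open_nbhs_nbhs (conj (open_cell cK0) K0q)).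
have E : K0 = L by apply: (cells_disjoint n0 cK0 cL); exists w.
by apply: (boundary_notin cL Lq); rewrite -E.
Qed.

Variable (u : set V -> R).

Lemma cellwiseE K x : cells M K -> K x -> cellwise M u x = u K.
Proof.
move=> cK Kx; have [cs ucs csE] := finite_uniq_seq (cells_finite M).
have Kcs : K \in cs by move: cK; rewrite csE.
rewrite /cellwise csE -fsbig_seq// (bigD1_seq K)//= indicE mem_set// mulr1.
rewrite big_seq_cond big1 ?addr0// => L /andP[Lcs LK].
have cL : cells M L by rewrite csE.
rewrite indicE memNset ?mulr0// => Lx; move/eqP: LK; apply.
by apply: (cells_disjoint n0 cL cK); exists x.
Qed.

Lemma measurable_cellwise (D : set (borelRV R n.+1)) :
  measurable_fun D (cellwise M u : borelRV R n.+1 -> R).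
Proof.
have [cs ucs csE] := finite_uniq_seq (cells_finite M).
(* [measurable_sum] asks for the measurability of all the terms *)
pose cell_or_empty (K : set V) : set V := if `[< cells M K >] then K else set0.
rewrite (_ : cellwise M u = fun x => \sum_(K <- cs) u K * \1_(cell_or_empty K) x).
  apply: measurable_sum => K; apply: measurable_funM; first exact: measurable_cst.
  apply: measurable_indic; rewrite /cell_or_empty; case: asboolP => [cK|_].
    by apply: measurable_open_RV; exact: open_cell cK.
  exact: measurable0.
apply/funext => x; rewrite /cellwise csE -fsbig_seq//; apply: eq_big_seq => K Kcs.
have cK : cells M K by rewrite csE.
by rewrite /cell_or_empty; case: asboolP.
Qed.

(** At most one diamond contains [x], and the normal of its face is a unit
    vector. *)
Lemma discrete_gradient_diamond s x : interior_faces M s -> diamond M s x ->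
  enorm (discrete_gradient M u x) = `|slope M u s|.
Proof.
move=> ints Dx.
have [fs ufs fsE] : exists2 fs, uniq fs & interior_faces M = [set` fs].
  by apply: finite_uniq_seq; apply: sub_finite_set (faces_finite M) => ? [].
have sfs : s \in fs by move: ints; rewrite fsE.
rewrite /discrete_gradient fsE -fsbig_seq// (bigD1_seq s)//= big_seq_cond big1.
  rewrite addr0 enormZ (enorm_normal bO mu0 star ints) mulr1.
  by rewrite indicE mem_set// mulr1.
move=> t /andP[tfs ts]; have intt : interior_faces M t by rewrite fsE.
rewrite indicE memNset ?mulr0 ?scale0r// => tx; move/eqP: ts; apply.
by apply: (diamond_disjoint n0 bO mu0 star intt ints); exists x.
Qed.

End LocalEstimate.

(** * Integration over a cube of targets *)

Section Final.
Variables (R : realType) (n : nat).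
Local Notation V := 'rV[R]_n.+1.
Variables (Omega : set V) (M : mesh Omega) (mu lambda : R).
Hypotheses (n0 : (0 < n)%N) (oO : open Omega) (bO : bounded_set Omega).
Hypotheses (mu0 : 0 < mu) (lambda0 : 0 < lambda) (reg : regular_mesh M mu lambda).
Variable (u : set V -> R).
Local Notation h := (mesh_size M).

Let star := reg.1.

Let measurable_Omega : measurable (Omega : set (borelRV R n.+1)).
Proof. exact: measurable_open_RV. Qed.

(** The diamonds are pairwise disjoint, and they are contained in [Omega] up to
    the boundaries of the cells. The null set [N] also contains [x], where the
    kernel takes the value 0. *)
Lemma sum_diamonds_le (IF : seq (set V)) (A : set V -> R) (x : V) : uniq IF ->
  interior_faces M = [set` IF] ->
  (forall s, s \in IF -> 0 < A s) ->
  (forall s, s \in IF -> forall xi, diamond M s xi -> enorm (x - xi) <= A s) ->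
  (\sum_(s <- IF) (`|slope M u s| / A s ^+ n)%:E * leb R n.+1 (diamond M s) <=
   \int[leb R n.+1]_(xi in Omega)
     (enorm (discrete_gradient M u xi) / enorm (x - xi) ^+ n)%:E)%E.
Proof.
move=> uIF IFE A0 DA.
have ints s : s \in IF -> interior_faces M s by rewrite IFE.
have [N [mN N0 HN]] := negligibleU (boundary_negligible M) (singleton_negligible x).
pose E (s : set V) := diamond M s `&` Omega `&` ~` N.
have mE s : measurable (E s : set (borelRV R n.+1)).
  apply: measurableI; last exact: measurableC.
  by apply: measurableI => //; apply: measurable_open_RV; exact: diamond_open.
pose c s := `|slope M u s| / A s ^+ n.
have c0 s : s \in IF -> 0 <= c s.
  by move=> sIF; rewrite divr_ge0// exprn_ge0// ltW// A0.
pose c' s := if s \in IF then c s else 0.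
have c'0 s : 0 <= c' s by rewrite /c'; case: ifPn => // /c0.
have Enull s : s \in IF -> (leb R n.+1 (diamond M s) <= leb R n.+1 (E s))%E.
  move=> sIF; apply: (@le_trans _ _ (leb R n.+1 (E s `|` N))).
    apply: le_measure; rewrite ?inE.
    - by apply: measurable_open_RV; exact: diamond_open.
    - exact: measurableU.
    move=> y Dy; have [Ny|Ny] := pselect (N y); [by right|left].
    split => //; split => //.
    have [c1 c2 _ _ _] := adjacentP (ints _ sIF).
    have inO K : cells M K -> closure K y -> Omega y.
      move=> cK Ky; apply: (subset_cell cK); apply: contrapT => nK; apply: Ny.
      apply: HN; left; exists K => //; split => //.
      by rewrite ((interior_id K).1 (open_cell cK)).
    by have [] := diamond_sub bO mu0 star (ints _ sIF) Dy; exact: inO.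
  by apply: le_trans (measureU2 _ _ _) _ => //; rewrite [X in (_ + X)%E]N0 adde0.
apply: (@le_trans _ _ (\sum_(s <- IF) (c' s)%:E * leb R n.+1 (E s))%E).
  rewrite big_seq [leRHS]big_seq; apply: lee_sum => s sIF; rewrite /c' sIF.
  by apply: lee_wpmul2l; [rewrite lee_fin c0|exact: Enull].
have intE s : (\int[leb R n.+1]_(xi in Omega) ((c' s)%:E * (\1_(E s) xi)%:E) =
    (c' s)%:E * leb R n.+1 (E s))%E.
  rewrite ge0_integralZl_EFin//.
  - rewrite integral_indic// setIidl// => y [[]]//.
  - by apply/measurable_EFinP; exact: measurable_indic.
rewrite -(eq_bigr _ (fun s _ => intE s)) -ge0_integral_sum//; last 2 first.
- move=> s; apply: emeasurable_funM; first exact: measurable_cst.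
  by apply/measurable_EFinP; exact: measurable_indic.
- by move=> s y _; rewrite -EFinM lee_fin mulr_ge0.
apply: ge0_le_integral_nonmeasurable => y Oy.
  by apply: sume_ge0 => s _; rewrite -EFinM lee_fin mulr_ge0.
have f0 : 0 <= enorm (discrete_gradient M u y) / enorm (x - y) ^+ n.
  by rewrite divr_ge0 ?exprn_ge0 ?enorm_ge0.
have [[s [sIF Es]]|nE] := pselect (exists s, s \in IF /\ E s y); last first.
  rewrite big_seq big1 ?lee_fin// => s sIF.
  by rewrite indicE memNset ?mule0// => Es; apply: nE; exists s.
rewrite (bigD1_seq s)//= big_seq_cond big1 ?adde0.
  have [[Dy _] Ny] := Es; rewrite indicE mem_set// mule1 lee_fin /c' sIF.
  rewrite (discrete_gradient_diamond n0 bO mu0 reg u (ints _ sIF) Dy).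
  have xy : 0 < enorm (x - y).
    rewrite enorm_gt0 subr_eq0; apply/eqP => xy; apply: Ny; apply: HN; right.
    by rewrite /= xy.
  rewrite ler_wpM2l// lef_pV2 ?posrE ?exprn_gt0 ?A0//.
  by apply: lerXn2r; rewrite ?nnegrE ?enorm_ge0 ?(ltW (A0 _ sIF)) ?(DA _ sIF).
move=> t /andP[tIF ts]; rewrite indicE memNset ?mule0// => Et.
move/eqP: ts; apply; apply: (diamond_disjoint n0 bO mu0 star (ints _ tIF) (ints _ sIF)).
by exists y; split; [case: Et => -[]|case: Es => -[]].
Qed.

Definition cone_cube_radius (theta rho : R) : R :=
  rho * (1 - cos theta) / 8 / n.+2%:R.

(** The first factor is the inverse of the measure of the cube of [cone_cube],
    over which the inequality along segments is averaged. *)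
Definition representation_const (theta rho : R) : R :=
  ((2 * cone_cube_radius theta rho) ^+ n.+1)^-1 * (1 + face_const n lambda rho).

Lemma face_const_ge0 rho : 0 < rho -> 0 <= face_const n lambda rho.
Proof.
move=> rho0; have [B0 _] := unit_ball_hausdorff_gt0 R n0.
by rewrite divr_ge0 ?mulr_ge0 ?exprn_ge0 ?(ltW B0)// ?mulr_ge0// ltW.
Qed.

(** The inequality [segment_jump] holds for almost all [y] in a cube contained in
    the cone with vertex [x]. Integrating over [y] turns each crossing indicator
    into the measure of a shadow, which [face_estimate] converts into the
    integral of the kernel over a diamond. *)
Lemma cell_estimate (theta rho : R) (K0 : set V) (x : V) :
  0 < theta < pi / 2 -> 0 < rho -> cone_condition theta rho Omega ->
  cells M K0 -> K0 x ->
  (`|u K0|%:E <= (representation_const theta rho)%:E * (norm01 M u +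
    \int[leb R n.+1]_(xi in Omega)
      (enorm (discrete_gradient M u xi) / enorm (x - xi) ^+ n)%:E))%E.
Proof.
move=> th rho0 hcone cK0 K0x.
have Ox : Omega x := subset_cell cK0 K0x.
have [e e1 coneO] := hcone x (subset_closure Ox).
pose r := cone_cube_radius theta rho.
have r0 : 0 < r.
  rewrite divr_gt0// divr_gt0// mulr_gt0// subr_gt0 lt_neqAle cos_le1 andbT.
  apply/eqP => c1; have := sin2cos2 theta; rewrite c1 expr1n subrr => /eqP.
  by rewrite sqrf_eq0 gt_eqF// sin_gt0_pihalf.
pose Q := cube (x + (rho / 2) *: e) r.
have Qcone : Q `<=` cone theta rho x e by exact: cone_cube.
have QO : Q `<=` Omega by exact: subset_trans Qcone coneO.
have mQ : measurable (Q : set (borelRV R n.+1)) by apply: measurable_cube; exact: ltW.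
pose q := (2 * r) ^+ n.+1.
have q0 : 0 < q by rewrite exprn_gt0// mulr_gt0.
have lQ : leb R n.+1 Q = q%:E by rewrite leb_cube// ltW.
have [IF uIF IFE] : exists2 fs, uniq fs & interior_faces M = [set` fs].
  by apply: finite_uniq_seq; apply: sub_finite_set (faces_finite M) => ? [].
have ints s : s \in IF -> interior_faces M s by rewrite IFE.
have /choice[TA HTA] : forall s, exists TA : set V * R,
    measurable (TA.1 : set (borelRV R n.+1)) /\ (s \in IF -> [/\ 0 < TA.2,
    shadow x (closure s) `&` [set y | enorm (y - x) <= rho] `<=` TA.1,
    forall xi, diamond M s xi -> enorm (x - xi) <= TA.2 &
    ((jump M u s)%:E * leb R n.+1 TA.1 <= (face_const n lambda rho)%:E *
      ((`|slope M u s| / TA.2 ^+ n)%:E * leb R n.+1 (diamond M s)))%E]).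
  move=> s; have [sIF|_] := boolP (s \in IF); last first.
    by exists (set0, 0); split => //; exact: measurable0.
  have [T [A [mT A0 ST DA TA]]] :=
    face_estimate n0 bO mu0 lambda0 reg u x rho0 (ints _ sIF).
  by exists (T, A).
have mT s : measurable ((TA s).1 : set (borelRV R n.+1)) by have [] := HTA s.
have J0 s : 0 <= jump M u s by exact: normr_ge0.
pose F (y : V) : \bar R := (`|cellwise M u y|%:E +
  \sum_(s <- IF) (jump M u s)%:E * (\1_((TA s).1) y)%:E)%E.
have mcell D : measurable_fun D
    ((fun y => `|cellwise M u y|%:E) : borelRV R n.+1 -> \bar R).
  apply/measurable_EFinP; apply: measurableT_comp; first exact: normr_measurable.
  exact: measurable_cellwise.
have mterm s D : measurable_fun D
   ((fun y => (jump M u s)%:E * (\1_((TA s).1) y)%:E)%E : borelRV R n.+1 -> \bar R).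
  apply: emeasurable_funM; first exact: measurable_cst.
  by apply/measurable_EFinP; exact: measurable_indic.
have term0 s y : (0 <= (jump M u s)%:E * (\1_((TA s).1) y)%:E)%E.
  by rewrite -EFinM lee_fin mulr_ge0.
have sum0 y : (0 <= \sum_(s <- IF) (jump M u s)%:E * (\1_((TA s).1) y)%:E)%E.
  by apply: sume_ge0.
have msum D : measurable_fun D ((fun y =>
   \sum_(s <- IF) (jump M u s)%:E * (\1_((TA s).1) y)%:E)%E : borelRV R n.+1 -> \bar R).
  by apply: emeasurable_sum => s.
have ptw : {ae leb R n.+1, forall y, Q y -> (`|u K0|%:E <= F y)%E}.
  have := negligibleU (boundary_negligible M)
    (bad_targets_negligible n0 bO rho cK0 K0x).
  apply: negligibleS => y nF; apply: contrapT => Hy; apply: nF => Qy.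
  have [yrho yc] := Qcone _ Qy.
  have Oy := QO _ Qy.
  have [K1 cK1 K1y'] : (\bigcup_(K in cells M) closure K) y.
    by rewrite -mesh_cover; exact: subset_closure.
  have K1y : K1 y.
    apply: contrapT => nK; apply: Hy; left; exists K1 => //; split => //.
    by rewrite ((interior_id K1).1 (open_cell cK1)).
  have seg t : 0 <= t <= 1 -> closure Omega (x + t *: (y - x)).
    move=> /andP[t0 t1]; apply: subset_closure.
    move: t0; rewrite le_eqVlt => /orP[/eqP<-|t0]; first by rewrite scale0r addr0.
    apply: coneO; rewrite /cone/= addrC addKr enormZ gtr0_norm// dotvZl.
    rewrite mulrCA ltr_pM2l//; split => //; apply: le_lt_trans yrho.
    by rewrite ler_piMl ?enorm_ge0.
  have gen K L : cells M K -> cells M L ->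
      hausdorff n (closure K `&` boundary L) = 0%E ->
      ~ shadow x (closure K `&` boundary L) y.
    move=> cK cL H0 sh; apply: Hy; right; exists K => //; exists L => //.
    by split => //; split => //=; exact: ltW.
  have := segment_jump n0 bO mu0 star u uIF IFE cK0 cK1 K0x K1y seg gen.
  rewrite /F (cellwiseE n0 u cK1 K1y) => Hj.
  under eq_bigr do rewrite -EFinM.
  rewrite sumEFin -EFinD lee_fin.
  rewrite -(subrK (u K1) (u K0)) addrC; apply: le_trans (ler_normD _ _) _.
  rewrite lerD2l; apply: le_trans Hj _.
  rewrite big_seq [leRHS]big_seq; apply: ler_sum => s sIF.
  rewrite /jump ler_wpM2l// !indicE.
  have [sh|nsh] := pselect (shadow x (closure s) y); last by rewrite memNset.
  rewrite !mem_set//; have [_ /(_ sIF)[_ + _ _]] := HTA s; apply.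
  by split => //=; exact: ltW.
have IQ : (`|u K0|%:E * q%:E <= norm01 M u +
    \sum_(s <- IF) (jump M u s)%:E * leb R n.+1 (TA s).1)%E.
  rewrite -lQ -integral_cst//.
  apply: (@le_trans _ _ (\int[leb R n.+1]_(y in Q) F y)%E).
    apply: ae_ge0_le_integral => //.
    - by move=> y _; rewrite lee_fin.
    - by move=> y _; rewrite adde_ge0// lee_fin.
    - by apply: emeasurable_funD.
  rewrite ge0_integralD//.
  apply: leeD.
    by apply: ge0_subset_integral => // y _; rewrite lee_fin.
  rewrite ge0_integral_sum//; apply: lee_sum => s _.
  rewrite ge0_integralZl_EFin//.
  - apply: lee_wpmul2l; first by rewrite lee_fin.
    rewrite integral_indic//; apply: le_measure; rewrite ?inE//.
    exact: measurableI.
  - by apply/measurable_EFinP; exact: measurable_indic.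
set G := (\int[leb R n.+1]_(xi in Omega) _)%E.
have fc0 := face_const_ge0 rho0.
have SG : (\sum_(s <- IF) (jump M u s)%:E * leb R n.+1 (TA s).1 <=
    (face_const n lambda rho)%:E * G)%E.
  apply: (@le_trans _ _ (\sum_(s <- IF) (face_const n lambda rho)%:E *
      ((`|slope M u s| / (TA s).2 ^+ n)%:E * leb R n.+1 (diamond M s)))%E).
    rewrite big_seq [leRHS]big_seq; apply: lee_sum => s sIF.
    by have [_ /(_ sIF)[]] := HTA s.
  have A0 s : s \in IF -> 0 < (TA s).2 by move=> sIF; have [_ /(_ sIF)[]] := HTA s.
  rewrite big_seq -ge0_sume_distrr -?big_seq; last first.
    move=> s sIF; apply: mule_ge0 => //.
    by rewrite lee_fin divr_ge0// exprn_ge0// ltW// A0.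
  apply: lee_wpmul2l; first by rewrite lee_fin.
  by apply: sum_diamonds_le => // s sIF; have [_ /(_ sIF)[]] := HTA s.
have N0 : (0 <= norm01 M u)%E by apply: integral_ge0 => y _; rewrite lee_fin.
have G0 : (0 <= G)%E.
  apply: integral_ge0 => y _.
  by rewrite lee_fin divr_ge0 ?exprn_ge0 ?enorm_ge0.
rewrite /representation_const -/r -/q EFinM -muleA.
have qE : (`|u K0|%:E = (q^-1)%:E * (`|u K0|%:E * q%:E))%E.
  by rewrite -!EFinM mulrCA mulVf ?mulr1// gt_eqF.
rewrite qE; apply: lee_wpmul2l; first by rewrite lee_fin invr_ge0 ltW.
apply: le_trans IQ _.
apply: (@le_trans _ _ (norm01 M u + (face_const n lambda rho)%:E * G)%E).
  exact: leeD2l.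
rewrite EFinD ge0_muleDl ?lee_fin// mul1e.
apply: leeD; first by rewrite leeDl.
by apply: lee_wpmul2l; [rewrite lee_fin|rewrite leeDr].
Qed.

End Final.

(** * The representation formula *)

Theorem proposition1 (R : realType) (d : nat) (hd : (2 <= d)%N)
    (Omega : set 'rV[R]_d) (hOmega : polyhedral_domain Omega)
    (theta rho : R) (htheta : 0 < theta < pi / 2) (hrho : 0 < rho)
    (hcone : cone_condition theta rho Omega)
    (lambda : R) (hlambda : 0 < lambda <= 1 / 2) :
  exists C : R, forall (M : mesh Omega) (mu : R),
    0 < mu <= 1 / 2 -> regular_mesh M mu lambda ->
    forall u : set 'rV[R]_d -> R,
    {ae leb R d, forall x : 'rV[R]_d, Omega x ->
      (`|cellwise M u x|%:E <=
       C%:E * (norm01 M u +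
               \int[leb R d]_(xi in Omega)
                 (enorm (discrete_gradient M u xi)
                    / enorm ((x : 'rV[R]_d) - xi) ^+ d.-1)%:E))%E}.
Proof.
case: d hd Omega hOmega hcone => [//|n] hd Omega hOmega hcone.
have n0 : (0 < n)%N by rewrite -ltnS.
have [oO _ bO _ _] := hOmega.
exists (representation_const n lambda theta rho) => M mu /andP[mu0 _] reg u.
have /andP[lambda0 _] := hlambda.
have := boundary_negligible M; apply: negligibleS => x nx.
apply: contrapT => Hx; apply: nx => Ox.
have [K cK Kx'] : (\bigcup_(K in cells M) closure K) x.
  by rewrite -mesh_cover; exact: subset_closure.
have Kx : K x.
  apply: contrapT => nK; apply: Hx; exists K => //; split => //.
  by rewrite ((interior_id K).1 (open_cell cK)).
rewrite (cellwiseE n0 u cK Kx).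
exact: (cell_estimate n0 oO bO mu0 lambda0 reg u htheta hrho hcone cK Kx).
Qed.
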